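(* There exist an absolute constant $c>0$ and constants $C(p,q)>0$, for real $1\le q\le p\le 2$ with $q<2$, satisfying $C(p,q)\ge c\,(2-q)$, such that for every $n\ge1$, every $A\in M_2(\mathbb{C})^{\otimes n}$ with $\|A\|_{\infty}\leq 1$, and all $1\le q\le p\le 2$ with $q<2$, $$\frac{\mathcal{E}_p[A]}{\left[1+ \frac{q}{2(2-q)}\ln^{+} \left(\mathcal{E}_p[A]\,/\,\mathcal{E}_q[A]^{2/q}\right)\right]^{p/2}} \;\geq\; C(p,q)\, \mathrm{Var}(A).$$ (If $\mathrm{Var}(A)=0$, the left-hand side is read as $0$.)
   Context: On $M_2(\mathbb{C})^{\otimes n}\cong M_{2^n}(\mathbb{C})$ let $\tau=2^{-n}\mathrm{tr}$ be the normalized trace, $|A|=(A^*A)^{1/2}$, $\|A\|_p=\tau(|A|^p)^{1/p}$ for $1\le p<\infty$, and $\|A\|_\infty$ the operator norm. $\mathrm{Var}(A)=\|A-\tau(A)\mathbf 1\|_2^2$. For $j\in[n]=\{1,\dots,n\}$, $\tau_j$ is the map acting as $\frac12\mathrm{tr}(\cdot)\mathbf 1$ on the $j$-th tensor factor and as the identity on the other factors, and $d_j A=A-\tau_j(A)$. Let $|\nabla A|=\left(\sum_{j=1}^n|d_jA|^2\right)^{1/2}$ and $\mathcal{E}_p[A]=\||\nabla A|\|_p^p$. $\ln^+(x)=\max\{\ln x,0\}$. *)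

(* Defs.v *)
From mathcomp Require Import all_boot all_order all_algebra.
From mathcomp Require Import complex.
From mathcomp Require Import classical_sets reals exp.

Set Implicit Arguments.
Unset Strict Implicit.
Unset Printing Implicit Defensive.

Import Order.TTheory GRing.Theory Num.Theory.

Local Open Scope classical_set_scope.
Local Open Scope ring_scope.
Local Open Scope complex_scope.
Local Open Scope sesquilinear_scope.

(* M_2(C)^{(x) n} is realized as the matrices whose rows and columns are indexed
   by the computational basis {0,1}^n of (C^2)^{(x) n}; MathComp matrices being
   indexed by ordinals, basis vectors are accessed through enum_val/enum_rank. *)
Notation qbasis n := {ffun 'I_n -> 'I_2}.
Notation qmx R n := 'M[R[i]]_#|{: qbasis n}|.

Definition bits (n : nat) (k : 'I_#|{: qbasis n}|) : qbasis n := enum_val k.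
Definition ofbits (n : nat) (x : qbasis n) : 'I_#|{: qbasis n}| := enum_rank x.

Lemma ofbitsK (n : nat) : cancel (@ofbits n) (@bits n).
Proof. exact: enum_rankK. Qed.

Lemma card_qbasis (n : nat) : #|{: qbasis n}| = (2 ^ n)%N.
Proof. by rewrite card_ffun !card_ord. Qed.

Definition tens (R : realType) (n : nat) (B : 'I_n -> 'M[R[i]]_2) : qmx R n :=
  \matrix_(k, l) \prod_(i < n) B i (bits k i) (bits l i).

Definition setbit (n : nat) (j : 'I_n) (b : 'I_2) (x : qbasis n) : qbasis n :=
  [ffun i => if i == j then b else x i].

(* In the basis, <x| tau_j(A) |y> vanishes unless x_j = y_j, and is then half the
   partial trace of A over the j-th factor; see tauj_tens. *)
Definition tauj (R : realType) (n : nat) (j : 'I_n) (A : qmx R n) : qmx R n :=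
  \matrix_(k, l)
    (if bits k j == bits l j then
       2^-1 * \sum_(b < 2) A (ofbits (setbit j b (bits k)))
                             (ofbits (setbit j b (bits l)))
     else 0).

Lemma tauj_tens (R : realType) (n : nat) (j : 'I_n) (B : 'I_n -> 'M[R[i]]_2) :
  tauj j (tens B) =
  tens (fun i => if i == j then (2^-1 * \tr (B i))%:M else B i).
Proof.
apply/matrixP => k l; rewrite !mxE (bigD1 j) //= eqxx mxE.
set P := \prod_(i < n | i != j) _.
case: eqP => _; last by rewrite mulr0n mul0r.
rewrite mulr1n /mxtrace -mulrA mulr_suml; congr (_ * _).
apply: eq_bigr => b _; rewrite mxE (bigD1 j) //= !ofbitsK !ffunE eqxx.
congr (_ * _); apply: eq_bigr => i /negPf ij.
by rewrite !ffunE ij.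
Qed.

Definition tau (R : realType) (n : nat) (A : qmx R n) : R[i] :=
  (2 ^+ n)^-1 * \tr A.

Definition dj (R : realType) (n : nat) (j : 'I_n) (A : qmx R n) : qmx R n :=
  A - tauj j A.

(* Functional calculus f(A) for Hermitian A (whose eigenvalues are real, so that
   taking their real parts loses nothing); only applied to such A below. *)
Definition hermfun (R : realType) (m : nat) (f : R -> R) (A : 'M[R[i]]_m) :
    'M[R[i]]_m :=
  invmx (spectralmx A)
    *m diag_mx (map_mx (fun z => (f (complex.Re z))%:C) (spectral_diag A))
    *m spectralmx A.

Definition absmx (R : realType) (m : nat) (A : 'M[R[i]]_m) : 'M[R[i]]_m :=
  hermfun Num.sqrt (A^t* *m A).

Definition powmx (R : realType) (m : nat) (A : 'M[R[i]]_m) (p : R) :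
    'M[R[i]]_m :=
  hermfun (fun x => x `^ p) A.

Definition pnorm (R : realType) (n : nat) (p : R) (A : qmx R n) : R :=
  (complex.Re (tau (powmx (absmx A) p))) `^ p^-1.

Definition l2norm (R : realType) (m : nat) (v : 'cV[R[i]]_m) : R :=
  Num.sqrt (\sum_(k < m) complex.Re (`|v k 0| ^+ 2)).

Definition opnorm (R : realType) (m : nat) (A : 'M[R[i]]_m) : R :=
  sup [set l2norm (A *m v) | v in [set v : 'cV[R[i]]_m | l2norm v = 1]].

Definition variance (R : realType) (n : nat) (A : qmx R n) : R :=
  (pnorm 2 (A - (tau A)%:M)) ^+ 2.

Definition absgrad (R : realType) (n : nat) (A : qmx R n) : qmx R n :=
  hermfun Num.sqrt (\sum_(j < n) absmx (dj j A) *m absmx (dj j A)).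

Definition energy (R : realType) (n : nat) (p : R) (A : qmx R n) : R :=
  (pnorm p (absgrad A)) `^ p.

Definition lnplus (R : realType) (x : R) : R := Num.max (ln x) 0.

(* Main.v *)
Require Import Defs.
From mathcomp Require Import all_boot all_order all_algebra.
From mathcomp Require Import complex.
From mathcomp Require Import classical_sets reals sequences exp.
From mathcomp Require Import ring lra.

Import Order.TTheory GRing.Theory Num.Theory.

Local Open Scope ring_scope.
Local Open Scope complex_scope.
Local Open Scope sesquilinear_scope.

Set Implicit Arguments.
Unset Strict Implicit.
Unset Printing Implicit Defensive.

(** Let [E_p] denote the energy.  By the power mean inequality
    [E_1 ^+ 2 <= E_q `^ (2 / q)], so the logarithm is largest at [q = 1]; since
    [q / (2 (2 - q)) <= 1 / (2 - q)] and [p / 2 <= 1], it is enough to bound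
    [variance A * (1 + ln^+ (E_p / E_1 ^+ 2)) `^ (p / 2)] by a constant times
    [E_p], and the factor [2 - q] absorbs the rest.

    Let [L] be the sum of the [dj j], diagonal in the Weyl basis with eigenvalue
    the number [wt S] of active sites, and let [R_s = (1 + s L)^-1].  The
    variance is the total Fourier weight off the zero frequency, and it is cut
    at a frequency size [m].

    High frequencies ([energy_bound], [fourier_tail]).  The resolvent [R_s] is a
    positive map: this follows from the minimum principle for [L], and it gives
    the Kadison-Schwarz inequality for [R_s] and then
    [s |grad R_s^2 A|^2 <= 1] when the operator norm of [A] is at most 1
    ([psd_res], [kadison_schwarz_res], [gradient_bound]).  Pairing the gradient
    of [A] with that of [R_s^2 A] and using Young's inequality with exponent [p]
    bounds [<A, s L R_s^2 A>] by [4 s `^ (p / 2) E_p].  Summing over geometric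
    scales below [1 / m] bounds the weight above [m] by a constant times
    [m `^ (- p / 2) E_p].

    Low frequencies ([noisy_bound], [fourier_low]).  With [g] the gradient of
    [R_1^2 A], hypercontractivity and interpolation between exponents 1 and 2
    give [|noise g|_2^2 <= E_1(g) E_2(g)^(1/2)].  Here [E_1(g) <= E_1] by a
    duality argument with the polar part, and [E_2(g) <= 4 E_p] by the first
    part at scale 1.  So the weight below [m] is at most [256^m] times
    [2 E_1 E_p^(1/2)].  The hypercontractive input is a bound of the 4-norm by
    the 2-norm, which follows from a convolution inequality on the group of
    frequencies ([noise_product]).

    Taking [m] of the order of [ln^+ (E_p / E_1 ^+ 2)] balances the two parts
    ([balance_threshold]).  All pairings are estimated by [duality], which
    evaluates them in an eigenbasis of the squared gradient and so reduces
    noncommutative Hoelder estimates to inequalities on finite sequences of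
    reals. *)

(** * The real Hilbert-Schmidt inner product *)

Section RealInnerProduct.
Variable R : realType.
Implicit Types m p : nat.

Definition rip m p (X Y : 'M[R[i]]_(m, p)) : R := complex.Re (\tr (X^t* *m Y)).

Lemma Re_sum (I : Type) (r : seq I) (P : pred I) (F : I -> R[i]) :
  complex.Re (\sum_(i <- r | P i) F i) = \sum_(i <- r | P i) complex.Re (F i).
Proof. exact: (raddf_sum (@complex.Re R : Rcomplex R -> R)). Qed.

Lemma ReZ (a : R) (z : R[i]) : complex.Re (a%:C * z) = a * complex.Re z.
Proof. by case: z => x y /=; rewrite mul0r subr0. Qed.

Lemma ImZ (a : R) (z : R[i]) : complex.Im (a%:C * z) = a * complex.Im z.
Proof. by case: z => x y /=; rewrite mul0r addr0. Qed.

Lemma conjR (a : R) : Num.conj a%:C = a%:C.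
Proof. exact: conjc_real. Qed.

Lemma Re_mulJ (x y : R[i]) :
  complex.Re (Num.conj x * y) =
  complex.Re x * complex.Re y + complex.Im x * complex.Im y.
Proof. by case: x => a b; case: y => c d /=; rewrite mulNr opprK. Qed.

Lemma ripE m p (X Y : 'M[R[i]]_(m, p)) :
  rip X Y = \sum_i \sum_j (complex.Re (X i j) * complex.Re (Y i j)
                         + complex.Im (X i j) * complex.Im (Y i j)).
Proof.
rewrite /rip /mxtrace [RHS]exchange_big Re_sum; apply: eq_bigr => j _.
rewrite mxE Re_sum; apply: eq_bigr => i _.
by rewrite !mxE Re_mulJ.
Qed.

Lemma ripC m p (X Y : 'M[R[i]]_(m, p)) : rip X Y = rip Y X.
Proof.
rewrite !ripE; apply: eq_bigr => i _; apply: eq_bigr => j _.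
by rewrite [in LHS]mulrC [X in _ + X = _]mulrC.
Qed.

Lemma ripDr m p (X Y Z : 'M[R[i]]_(m, p)) : rip X (Y + Z) = rip X Y + rip X Z.
Proof. by rewrite /rip mulmxDr linearD raddfD. Qed.

Lemma ripNr m p (X Y : 'M[R[i]]_(m, p)) : rip X (- Y) = - rip X Y.
Proof. by rewrite /rip mulmxN linearN raddfN. Qed.

Lemma rip0r m p (X : 'M[R[i]]_(m, p)) : rip X 0 = 0.
Proof. by rewrite /rip mulmx0 linear0. Qed.

Lemma ripZr m p a (X Y : 'M[R[i]]_(m, p)) : rip X (a%:C *: Y) = a * rip X Y.
Proof. by rewrite /rip -scalemxAr linearZ /= ReZ. Qed.

Lemma rip_sumr m p (I : Type) (r : seq I) (P : pred I) (F : I -> 'M[R[i]]_(m, p)) X :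
  rip X (\sum_(i <- r | P i) F i) = \sum_(i <- r | P i) rip X (F i).
Proof. by elim/big_rec2: _ => [|i x y _ <-]; rewrite ?rip0r ?ripDr. Qed.

Lemma ripDl m p (X Y Z : 'M[R[i]]_(m, p)) : rip (Y + Z) X = rip Y X + rip Z X.
Proof. by rewrite ripC ripDr !(ripC X). Qed.

Lemma ripZl m p a (X Y : 'M[R[i]]_(m, p)) : rip (a%:C *: Y) X = a * rip Y X.
Proof. by rewrite ripC ripZr ripC. Qed.

Lemma rip_suml m p (I : Type) (r : seq I) (P : pred I) (F : I -> 'M[R[i]]_(m, p)) X :
  rip (\sum_(i <- r | P i) F i) X = \sum_(i <- r | P i) rip (F i) X.
Proof. by rewrite ripC rip_sumr; apply: eq_bigr => i _; rewrite ripC. Qed.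

Lemma rip_ge0 m p (X : 'M[R[i]]_(m, p)) : 0 <= rip X X.
Proof.
rewrite ripE; apply: sumr_ge0 => i _; apply: sumr_ge0 => j _.
by rewrite addr_ge0 // -expr2 sqr_ge0.
Qed.

Lemma adjmxM m n p (A : 'M[R[i]]_(m, n)) (B : 'M[R[i]]_(n, p)) :
  (A *m B)^t* = B^t* *m A^t*.
Proof. by rewrite trmx_mul map_mxM. Qed.

Lemma adjmxD m n (A B : 'M[R[i]]_(m, n)) : (A + B)^t* = A^t* + B^t*.
Proof. by rewrite linearD /= map_mxD. Qed.

Lemma adjmxN m n (A : 'M[R[i]]_(m, n)) : (- A)^t* = - A^t*.
Proof. by rewrite linearN /= map_mxN. Qed.

Lemma adjmxB m n (A B : 'M[R[i]]_(m, n)) : (A - B)^t* = A^t* - B^t*.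
Proof. by rewrite adjmxD adjmxN. Qed.

Lemma adjmxZ m n (a : R) (A : 'M[R[i]]_(m, n)) : (a%:C *: A)^t* = a%:C *: A^t*.
Proof. by apply/matrixP => i j; rewrite !mxE rmorphM; congr (_ * _); exact: conjR. Qed.

Lemma adjmx_sum m n (I : Type) (r : seq I) (P : pred I) (F : I -> 'M[R[i]]_(m, n)) :
  (\sum_(i <- r | P i) F i)^t* = \sum_(i <- r | P i) (F i)^t*.
Proof.
elim/big_rec2: _ => [|i x y _ <-]; last by rewrite adjmxD.
by apply/matrixP => i j; rewrite !mxE rmorph0.
Qed.

Lemma adjmx1 m : (1%:M : 'M[R[i]]_m)^t* = 1%:M.
Proof. by rewrite trmx1 map_mx1. Qed.

Lemma rip_mulml m n p (A : 'M[R[i]]_(n, m)) (X : 'M[R[i]]_(m, p)) Y :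
  rip (A *m X) Y = rip X (A^t* *m Y).
Proof. by rewrite /rip adjmxM mulmxA. Qed.

Lemma rip_mulmr m n p (X : 'M[R[i]]_(m, n)) (A : 'M[R[i]]_(n, p)) Y :
  rip (X *m A) Y = rip X (Y *m A^t*).
Proof. by rewrite /rip adjmxM -mulmxA mxtrace_mulC mulmxA. Qed.

Lemma rip_adj m p (X Y : 'M[R[i]]_(m, p)) : rip (X^t*) (Y^t*) = rip X Y.
Proof. by rewrite ripC /rip trmxCK mxtrace_mulC. Qed.

(** The discriminant form of Cauchy-Schwarz serves every positive form met
    below: finite sums of reals, [rip], and families of matrices. *)
Lemma sqr_le_of_quadratic (a b c : R) :
  0 <= a -> 0 <= c -> (forall s t, 0 <= s ^+ 2 * a + s * t * b *+ 2 + t ^+ 2 * c) ->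
  b ^+ 2 <= a * c.
Proof.
move=> a0 c0 H; have [a_0|an0] := eqVneq a 0.
  have [->|bn0] := eqVneq b 0; first by rewrite expr0n mulr_ge0.
  have := H (- (c + 1) / b) 1; rewrite a_0 mulr0 add0r expr1n mul1r.
  have -> : (- (c + 1) / b) * 1 * b = - (c + 1) by field.
  by move=> h; exfalso; lra.
have ap : 0 < a by rewrite lt_def an0.
have := H (- b) a; rewrite -(pmulr_rge0 _ (_ : 0 < a^-1)) ?invr_gt0 //.
have -> : a^-1 * ((- b) ^+ 2 * a + - b * a * b *+ 2 + a ^+ 2 * c) = a * c - b ^+ 2.
  by field.
by rewrite subr_ge0.
Qed.

Lemma cauchy_sum (I : finType) (x y : I -> R) :
  (\sum_i x i * y i) ^+ 2 <= (\sum_i x i ^+ 2) * (\sum_i y i ^+ 2).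
Proof.
apply: sqr_le_of_quadratic => [||s t]; try by apply: sumr_ge0 => i _; exact: sqr_ge0.
rewrite (_ : _ + _ = \sum_i (s * x i + t * y i) ^+ 2).
  by apply: sumr_ge0 => i _; exact: sqr_ge0.
rewrite !mulr_sumr -sumrMnl -!big_split; apply: eq_bigr => i _ /=; ring.
Qed.

Lemma cauchy_rip (I : finType) m p (X Y : I -> 'M[R[i]]_(m, p)) :
  (\sum_i rip (X i) (Y i)) ^+ 2 <=
  (\sum_i rip (X i) (X i)) * (\sum_i rip (Y i) (Y i)).
Proof.
apply: sqr_le_of_quadratic => [||s t]; try by apply: sumr_ge0 => i _; exact: rip_ge0.
rewrite (_ : _ + _ = \sum_i rip (s%:C *: X i + t%:C *: Y i) (s%:C *: X i + t%:C *: Y i)).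
  by apply: sumr_ge0 => i _; exact: rip_ge0.
rewrite !mulr_sumr -sumrMnl -!big_split; apply: eq_bigr => i _ /=.
rewrite !(ripDl, ripDr, ripZl, ripZr) (ripC (Y i) (X i)); ring.
Qed.

Lemma cauchy_rip1 m p (X Y : 'M[R[i]]_(m, p)) :
  rip X Y ^+ 2 <= rip X X * rip Y Y.
Proof.
by have := cauchy_rip (fun _ : 'I_1 => X) (fun=> Y); rewrite !big_ord1.
Qed.

Lemma le_sqrt_mul (a b c : R) : 0 <= a -> 0 <= c -> b ^+ 2 <= a * c ->
  b <= Num.sqrt a * Num.sqrt c.
Proof.
move=> a0 c0 h; rewrite -sqrtrM //; apply: le_trans (ler_norm b) _.
by rewrite -sqrtr_sqr ler_wsqrtr.
Qed.

End RealInnerProduct.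

(** * Positive semidefinite matrices *)

Section Positivity.
Variable R : realType.

Definition psd m (X : 'M[R[i]]_m) : Prop :=
  X^t* = X /\ forall v : 'cV_m, 0 <= rip v (X *m v).

Lemma psdD m (X Y : 'M[R[i]]_m) : psd X -> psd Y -> psd (X + Y).
Proof.
move=> [hX pX] [hY pY]; split; first by rewrite adjmxD hX hY.
by move=> v; rewrite mulmxDl ripDr addr_ge0.
Qed.

Lemma psd0 m : psd (0 : 'M[R[i]]_m).
Proof.
split; last by move=> v; rewrite mul0mx rip0r.
by apply/matrixP => i j; rewrite !mxE rmorph0.
Qed.

Lemma psdZ m a (X : 'M[R[i]]_m) : 0 <= a -> psd X -> psd (a%:C *: X).
Proof.
move=> a0 [hX pX]; split; first by rewrite adjmxZ hX.
by move=> v; rewrite -scalemxAl ripZr mulr_ge0.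
Qed.

Lemma psd_sum m (I : Type) (r : seq I) (P : pred I) (F : I -> 'M[R[i]]_m) :
  (forall i, P i -> psd (F i)) -> psd (\sum_(i <- r | P i) F i).
Proof. by move=> h; elim/big_rec: _ => [|i x Pi]; [exact: psd0|exact/psdD/h]. Qed.

Lemma psd_gram m p (X : 'M[R[i]]_(p, m)) : psd (X^t* *m X).
Proof.
split; first by rewrite adjmxM trmxCK.
by move=> v; rewrite -mulmxA -rip_mulml rip_ge0.
Qed.

Lemma psd_trans m (X Y Z : 'M[R[i]]_m) : psd (Y - X) -> psd (Z - Y) -> psd (Z - X).
Proof. by move=> h1 h2; have := psdD h2 h1; rewrite addrA subrK. Qed.

End Positivity.

(** * Functional calculus of Hermitian matrices *)

Section FunctionalCalculus.
Variables (R : realType) (m : nat).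
Implicit Types (U N : 'M[R[i]]_m) (f g : 'I_m -> R).

Definition cdiag f : 'M[R[i]]_m := diag_mx (\row_k (f k)%:C).

Lemma cdiagE f i j : cdiag f i j = (f j)%:C *+ (i == j).
Proof. by rewrite !mxE; case: eqP => // ->. Qed.

Lemma cdiagM f g : cdiag f *m cdiag g = cdiag (fun k => f k * g k).
Proof.
apply/matrixP => i j; rewrite mul_diag_mx !mxE; case: eqP => [->|_].
  by rewrite !mulr1n rmorphM.
by rewrite !mulr0n mulr0.
Qed.

Lemma adj_cdiag f : (cdiag f)^t* = cdiag f.
Proof.
apply/matrixP => i j; rewrite !mxE eq_sym; case: eqP => [->|_].
  by rewrite !mulr1n conjR.
by rewrite !mulr0n rmorph0.
Qed.

Lemma eq_cdiag f g : f =1 g -> cdiag f = cdiag g.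
Proof. by move=> fg; apply/matrixP => i j; rewrite !mxE fg. Qed.

Lemma cdiagB f g : cdiag f - cdiag g = cdiag (fun k => f k - g k).
Proof.
apply/matrixP => i j; rewrite !mxE; case: eqP => _; last by rewrite !mulr0n subr0.
by rewrite !mulr1n rmorphB.
Qed.

Definition specmx U f : 'M[R[i]]_m := U^t* *m cdiag f *m U.

Lemma unitary_mulC U : U \is unitarymx -> U^t* *m U = 1%:M.
Proof.
by move=> Uu; rewrite -invmx_unitary // mulVmx // unitarymx_unit.
Qed.

Lemma specmxM U f g : U \is unitarymx ->
  specmx U f *m specmx U g = specmx U (fun k => f k * g k).
Proof.
move=> Uu; rewrite /specmx !mulmxA -(mulmxA _ U) (unitarymxP Uu) mulmx1.
by rewrite -(mulmxA _ (cdiag f)) cdiagM.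
Qed.

Lemma adj_specmx U f : (specmx U f)^t* = specmx U f.
Proof. by rewrite /specmx !adjmxM trmxCK adj_cdiag mulmxA. Qed.

Lemma specmx1 U : U \is unitarymx -> specmx U (fun=> 1) = 1%:M.
Proof.
move=> Uu; rewrite /specmx (_ : cdiag _ = 1%:M) ?mulmx1 ?unitary_mulC //.
by apply/matrixP => i j; rewrite !mxE.
Qed.

Lemma specmx_const U (c : R) : U \is unitarymx ->
  specmx U (fun=> c) = c%:C *: 1%:M.
Proof.
move=> Uu; rewrite /specmx (_ : cdiag _ = c%:C *: 1%:M).
  by rewrite -scalemxAr mulmx1 -scalemxAl (unitary_mulC Uu).
by apply/matrixP => i j; rewrite !mxE mulrnAr mulr1.
Qed.

Lemma eq_specmx U f g : f =1 g -> specmx U f = specmx U g.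
Proof. by move=> fg; rewrite /specmx (eq_cdiag fg). Qed.

Lemma specmxB U f g : specmx U f - specmx U g = specmx U (fun k => f k - g k).
Proof. by rewrite /specmx -mulmxBl -mulmxBr cdiagB. Qed.

Lemma tr_specmx U f : U \is unitarymx -> complex.Re (\tr (specmx U f)) = \sum_k f k.
Proof.
move=> Uu; rewrite /specmx mxtrace_mulC mulmxA (unitarymxP Uu) mul1mx.
by rewrite Re_sum; apply: eq_bigr => k _; rewrite cdiagE eqxx.
Qed.

Definition eigval N (k : 'I_m) : R := complex.Re (spectral_diag N 0 k).

Lemma spectral_thm N : N^t* = N -> N = specmx (spectralmx N) (eigval N).
Proof.
move=> hN; have hh : N \is hermsymmx.
  by apply/is_hermitianmxP; rewrite expr0 scale1r -[LHS]hN.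
have /orthomx_spectralP {1}-> := hermitian_normalmx hh.
have /mxOverP Nr := hermitian_spectral_diag_real hh.
have dE : spectral_diag N = \row_k (eigval N k)%:C.
  by apply/matrixP => i j; rewrite ord1 !mxE /eigval RRe_real.
by rewrite (invmx_unitary (spectral_unitarymx N)) {1}dE.
Qed.

(** [hermfun] is defined through one chosen diagonalization; an intertwiner
    [M] of two diagonalizations satisfies [M i j * (f j - d i) = 0], so it also
    intertwines the images of the eigenvalues under any function. *)
Lemma hermfun_specmx (h : R -> R) U f : U \is unitarymx ->
  hermfun h (specmx U f) = specmx U (h \o f).
Proof.
move=> Uu; set N := specmx U f.
set V := spectralmx N; have Vu : V \is unitarymx := spectral_unitarymx N.
have eN : N = specmx V (eigval N) by apply: spectral_thm; rewrite adj_specmx.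
have -> : hermfun h N = specmx V (h \o eigval N).
  have dE : map_mx (fun z => (h (complex.Re z))%:C) (spectral_diag N) =
      \row_k (h (eigval N k))%:C by apply/matrixP => i j; rewrite !mxE ord1.
  by rewrite /hermfun (invmx_unitary Vu) dE.
set M := V *m U^t*.
have inter : cdiag (eigval N) *m M = M *m cdiag f.
  have : V *m N *m U^t* = V *m specmx U f *m U^t* by [].
  rewrite {1}eN /specmx /M !mulmxA (unitarymxP Vu) mul1mx => ->.
  by rewrite -!mulmxA (unitarymxP Uu) mulmx1.
have {}inter : cdiag (h \o eigval N) *m M = M *m cdiag (h \o f).
  move: M inter => K inter; apply/matrixP => i j; have /matrixP/(_ i j) := inter.
  rewrite /cdiag !mul_diag_mx !mul_mx_diag !mxE.
  have [->|Kn0] := eqVneq (K i j) 0; first by rewrite !mulr0 !mul0r.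
  rewrite mulrC => /(mulfI Kn0) /complexI /= ->; exact: mulrC.
have : V^t* *m (cdiag (h \o eigval N) *m M) *m U = V^t* *m (M *m cdiag (h \o f)) *m U.
  by rewrite inter.
rewrite /M !mulmxA (unitary_mulC Vu) mul1mx -(mulmxA _ (U^t*) U) (unitary_mulC Uu).
by rewrite mulmx1.
Qed.

Lemma mulmx_col p q (X : 'M[R[i]]_(p, m)) (Y : 'M[R[i]]_(m, q)) k :
  X *m col k Y = col k (X *m Y).
Proof. by rewrite !colE mulmxA. Qed.

Definition evec U (k : 'I_m) : 'cV[R[i]]_m := (row k U)^t*.

Lemma evecE U k : evec U k = col k (U^t*).
Proof. by apply/matrixP => i j; rewrite !mxE. Qed.

Lemma rip_evec_sum U p (X Y : 'M[R[i]]_(p, m)) : U \is unitarymx ->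
  rip X Y = \sum_k rip (X *m evec U k) (Y *m evec U k).
Proof.
move=> Uu.
have -> : rip X Y = rip (X *m U^t*) (Y *m U^t*).
  by rewrite rip_mulmr trmxCK -mulmxA unitary_mulC // mulmx1.
rewrite ripE exchange_big; apply: eq_bigr => k _.
rewrite ripE; apply: eq_bigr => i _.
by rewrite big_ord1 !evecE !mulmx_col !mxE.
Qed.

Lemma specmx_evec U f k : U \is unitarymx -> specmx U f *m evec U k = (f k)%:C *: evec U k.
Proof.
move=> Uu; rewrite evecE mulmx_col /specmx -!mulmxA (unitarymxP Uu) mulmx1.
by apply/matrixP => i j; rewrite mul_mx_diag !mxE mulrC.
Qed.

Lemma evec_unit U k : U \is unitarymx -> rip (evec U k) (evec U k) = 1.
Proof.
move=> Uu; rewrite /rip /evec trmxCK.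
have -> : row k U *m (row k U)^t* = (row k U) *m (col k (U^t*)).
  by congr (_ *m _); apply/matrixP => i j; rewrite !mxE.
rewrite /mxtrace big_ord1 -row_mul mulmx_col (unitarymxP Uu) !mxE eqxx //.
Qed.

Lemma eigval_ge0 N k : psd N -> 0 <= eigval N k.
Proof.
move=> [hN pN]; have Uu := spectral_unitarymx N.
have := pN (evec (spectralmx N) k).
by rewrite {2}(spectral_thm hN) specmx_evec // ripZr evec_unit // mulr1.
Qed.

Lemma rip_specmx U f (v : 'cV[R[i]]_m) :
  rip v (specmx U f *m v) = \sum_k f k * rip (row k (U *m v)) (row k (U *m v)).
Proof.
rewrite /specmx -!mulmxA ripC rip_mulml trmxCK ripE.
apply: eq_bigr => k _; rewrite ripE !big_ord1 !mul_diag_mx !mxE /= !ReZ.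
by rewrite ImZ mulrDr !mulrA.
Qed.

Lemma psd_specmx U f : (forall k, 0 <= f k) -> psd (specmx U f).
Proof.
move=> f0; split; first exact: adj_specmx.
by move=> v; rewrite rip_specmx sumr_ge0 // => k _; rewrite mulr_ge0 ?rip_ge0.
Qed.

End FunctionalCalculus.

(** * Singular values of a family of matrices and duality *)

Section Duality.
Variables (R : realType) (m : nat) (I : finType).
Implicit Types X Y : I -> 'M[R[i]]_m.

Definition gram X : 'M[R[i]]_m := \sum_i (X i)^t* *m X i.

(** Singular values of the column with entries [X i], that is, eigenvalues of
    the square root of [gram X]. *)
Definition sing X (k : 'I_m) : R := Num.sqrt (eigval (gram X) k).

(** Diagonal of [gram X] in the basis formed by the adjoint rows of [U]. *)
Definition dens X (U : 'M[R[i]]_m) (k : 'I_m) : R :=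
  rip (evec U k) (gram X *m evec U k).

Lemma eq_gram X Y : X =1 Y -> gram X = gram Y.
Proof. by move=> XY; apply: eq_bigr => i _; rewrite XY. Qed.

Lemma psd_gram_sum X : psd (gram X).
Proof. by apply: psd_sum => i _; exact: psd_gram. Qed.

Lemma sing_ge0 X k : 0 <= sing X k.
Proof. exact: sqrtr_ge0. Qed.

Lemma sqr_sing X k : sing X k ^+ 2 = eigval (gram X) k.
Proof. by rewrite sqr_sqrtr // eigval_ge0 //; exact: psd_gram_sum. Qed.

Lemma rip_gram X (v : 'cV[R[i]]_m) :
  rip v (gram X *m v) = \sum_i rip (X i *m v) (X i *m v).
Proof.
rewrite mulmx_suml rip_sumr; apply: eq_bigr => i _.
by rewrite -mulmxA -rip_mulml.
Qed.

Lemma dens_ge0 X U k : 0 <= dens X U k.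
Proof. by have [_] := psd_gram_sum X; exact. Qed.

Lemma dens_le X U k c : U \is unitarymx -> psd (c%:C *: 1%:M - gram X) ->
  dens X U k <= c.
Proof.
move=> Uu [_ /(_ (evec U k))].
by rewrite mulmxBl ripDr ripNr -scalemxAl mul1mx ripZr (evec_unit _ Uu) mulr1 subr_ge0.
Qed.

Lemma sum_dens X U : U \is unitarymx -> \sum_k dens X U k = \sum_i rip (X i) (X i).
Proof.
move=> Uu; rewrite /dens; under eq_bigr do rewrite rip_gram.
by rewrite exchange_big; apply: eq_bigr => i _; rewrite (rip_evec_sum _ _ Uu).
Qed.

Lemma sum_dens_sqr X U : U \is unitarymx ->
  \sum_k dens X U k ^+ 2 <= rip (gram X) (gram X).
Proof.
move=> Uu; rewrite [leRHS](rip_evec_sum _ _ Uu); apply: ler_sum => k _.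
have := cauchy_rip1 (evec U k) (gram X *m evec U k).
by rewrite (evec_unit _ Uu) mul1r => h; exact: h.
Qed.

Lemma dens_sing X k : dens X (spectralmx (gram X)) k = sing X k ^+ 2.
Proof.
have [h _] := psd_gram_sum X; have Uu := spectral_unitarymx (gram X).
rewrite /dens {2}(spectral_thm h) (specmx_evec _ _ Uu) ripZr (evec_unit _ Uu) mulr1.
by rewrite sqr_sing.
Qed.

Lemma sum_sing_sqr X : \sum_k sing X k ^+ 2 = \sum_i rip (X i) (X i).
Proof.
under eq_bigr do rewrite -dens_sing.
by rewrite sum_dens // spectral_unitarymx.
Qed.

(** At each eigenvector of [gram X] the pairing is bounded by Cauchy-Schwarz.
    Every Hoelder-type estimate on the pairing thus becomes an inequality on the
    numbers [sing X k] and [dens Y U k]. *)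
Lemma duality X Y :
  \sum_i rip (X i) (Y i) <=
  \sum_k sing X k * Num.sqrt (dens Y (spectralmx (gram X)) k).
Proof.
set U := spectralmx _; have Uu : U \is unitarymx by exact: spectral_unitarymx.
under eq_bigr do rewrite (rip_evec_sum _ _ Uu).
rewrite exchange_big; apply: ler_sum => k _.
have -> : sing X k = Num.sqrt (dens X U k).
  by rewrite dens_sing sqrtr_sqr ger0_norm // sing_ge0.
apply: le_sqrt_mul; rewrite ?dens_ge0 // /dens !rip_gram.
exact: (cauchy_rip (fun i => X i *m evec U k)).
Qed.

End Duality.

(** * Energy, variance and operator norm *)

Section AbstractNorms.
Variables (R : realType) (m : nat).
Implicit Types U N B : 'M[R[i]]_m.

Lemma hermfun_psd (h : R -> R) N : psd N ->
  hermfun h N = specmx (spectralmx N) (h \o eigval N).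
Proof.
by move=> [hN _]; rewrite {1}(spectral_thm hN) (hermfun_specmx _ _ (spectral_unitarymx N)).
Qed.

Lemma absmx_sqr B : absmx B *m absmx B = B^t* *m B.
Proof.
have pN := psd_gram B; have [hN _] := pN; have Uu := spectral_unitarymx (B^t* *m B).
rewrite /absmx (hermfun_psd _ pN) (specmxM _ _ Uu) [RHS](spectral_thm hN).
apply: eq_specmx => k /=; rewrite -expr2 sqr_sqrtr //.
by apply: eigval_ge0; exact: psd_gram.
Qed.

Lemma absmx_specmx U f : U \is unitarymx -> (forall k, 0 <= f k) ->
  absmx (specmx U f) = specmx U f.
Proof.
move=> Uu f0; rewrite /absmx adj_specmx (specmxM _ _ Uu) (hermfun_specmx _ _ Uu).
by apply: eq_specmx => k /=; rewrite -expr2 sqrtr_sqr ger0_norm.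
Qed.

Lemma tr_powmx U f p : U \is unitarymx ->
  complex.Re (\tr (powmx (specmx U f) p)) = \sum_k f k `^ p.
Proof. by move=> Uu; rewrite /powmx (hermfun_specmx _ _ Uu) (tr_specmx _ Uu). Qed.

Lemma tr_absmx_sqr B : complex.Re (\tr (powmx (absmx B) 2)) = rip B B.
Proof.
have pN := psd_gram B; have [hN _] := pN; have Uu := spectral_unitarymx (B^t* *m B).
rewrite /absmx (hermfun_psd _ pN) (tr_powmx _ _ Uu) /rip [in RHS](spectral_thm hN).
rewrite (tr_specmx _ Uu); apply: eq_bigr => k _ /=.
rewrite (powR_mulrn 2) ?sqrtr_ge0 // sqr_sqrtr //; exact: eigval_ge0.
Qed.

Lemma sqrt_gram (I : finType) (X : I -> 'M[R[i]]_m) :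
  hermfun Num.sqrt (gram X) = specmx (spectralmx (gram X)) (sing X).
Proof. by rewrite (hermfun_psd _ (psd_gram_sum X)). Qed.

End AbstractNorms.

Section Norms.
Variables (R : realType) (n : nat).
Implicit Types A B : qmx R n.

Local Notation dim := ((2 ^+ n)%R : R).

Lemma dim_gt0 : 0 < dim.
Proof. by rewrite exprn_gt0. Qed.

Lemma dimV_ge0 : 0 <= dim^-1.
Proof. by rewrite invr_ge0 ltW // dim_gt0. Qed.

Lemma Re_tau A : complex.Re (tau A) = dim^-1 * complex.Re (\tr A).
Proof.
rewrite /tau (_ : (2 ^+ n)^-1 = (dim^-1)%:C) ?ReZ //.
by rewrite fmorphV rmorphXn rmorph_nat.
Qed.

Lemma energyE p A : p != 0 ->
  energy p A = dim^-1 * \sum_k sing (fun j => dj j A) k `^ p.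
Proof.
move=> p0; have Uu := spectral_unitarymx (gram (fun j => dj j A)).
have aG : absgrad A = specmx (spectralmx (gram (fun j => dj j A))) (sing (fun j => dj j A)).
  rewrite -sqrt_gram; congr (hermfun Num.sqrt _).
  by apply: eq_bigr => j _; exact: absmx_sqr.
rewrite /energy /pnorm aG (absmx_specmx Uu (sing_ge0 _)) -powRrM (mulVf p0) Re_tau.
rewrite (tr_powmx _ _ Uu) powRr1; first exact: erefl.
apply: (mulr_ge0 dimV_ge0).
by apply: sumr_ge0 => k _; exact: powR_ge0.
Qed.

Lemma varianceE A :
  variance A = dim^-1 * rip (A - (tau A)%:M) (A - (tau A)%:M).
Proof.
have ge0 : 0 <= dim^-1 * rip (A - (tau A)%:M) (A - (tau A)%:M).
  by apply: (mulr_ge0 dimV_ge0); exact: rip_ge0.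
by rewrite /variance /pnorm Re_tau tr_absmx_sqr powR12_sqrt // sqr_sqrtr.
Qed.

End Norms.

Section OperatorNorm.
Variable R : realType.

Lemma l2normE m (v : 'cV[R[i]]_m) : l2norm v = Num.sqrt (rip v v).
Proof.
rewrite /l2norm ripE; congr Num.sqrt; apply: eq_bigr => i _.
by rewrite big_ord1 -add_Re2_Im2 /= -!expr2.
Qed.

Lemma rip_eq0 m p (X : 'M[R[i]]_(m, p)) : rip X X = 0 -> X = 0.
Proof.
rewrite ripE => /eqP; rewrite psumr_eq0; last first.
  by move=> i _; apply: sumr_ge0 => j _; rewrite addr_ge0 // -expr2 sqr_ge0.
move=> /allP h; apply/matrixP => i j; have := h i; rewrite mem_index_enum => /(_ isT).
rewrite psumr_eq0; last by move=> k _; rewrite addr_ge0 // -expr2 sqr_ge0.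
move=> /allP /(_ j); rewrite mem_index_enum => /(_ isT) /=.
rewrite -!expr2 paddr_eq0 ?sqr_ge0 // !sqrf_eq0 mxE => /andP[/eqP a /eqP b].
by apply/eqP; rewrite eq_complex a b /= eqxx.
Qed.

(** A bound on the supremum [opnorm A] says nothing about [A] until the set is
    known to be bounded, as [sup] has a default value; the Frobenius norm provides
    a bound. *)
Lemma opnorm_has_ubound m (A : 'M[R[i]]_m) :
  has_ubound [set l2norm (A *m v) | v in [set v : 'cV[R[i]]_m | l2norm v = 1]]%classic.
Proof.
exists (Num.sqrt (\sum_k rip (row k A) (row k A))) => _ [v v1 <-].
have {}v1 : rip v v = 1.
  have : l2norm v ^+ 2 = 1 by rewrite v1 expr1n.
  by rewrite l2normE sqr_sqrtr // rip_ge0.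
rewrite l2normE ler_wsqrtr //.
have -> : rip (A *m v) (A *m v) = \sum_k rip (row k (A *m v)) (row k (A *m v)).
  rewrite ripE; apply: eq_bigr => k _; rewrite ripE.
  by rewrite !big_ord1 !mxE.
apply: ler_sum => k _; set a := row k A; rewrite row_mul -/a.
set z := (a *m v).
have hz : rip z z = rip a (z *m v^t*) by rewrite {1}/z rip_mulmr.
have := cauchy_rip1 a (z *m v^t*); rewrite -hz.
have -> : rip (z *m v^t*) (z *m v^t*) = rip z z.
  rewrite rip_mulmr trmxCK -mulmxA.
  have -> : v^t* *m v = 1%:M.
    apply/matrixP => i j; rewrite !ord1 !mxE eqxx /=.
    have : \tr (v^t* *m v) = 1.
      apply/eqP; rewrite eq_complex /=; apply/andP; split; first exact/eqP.
      rewrite /mxtrace big_ord1 !mxE; apply/eqP.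
      elim/big_rec: _ => //= l x _ h.
      rewrite !mxE raddfD /= h; case: (v l ord0) => c d /=; ring.
    by rewrite /mxtrace big_ord1 !mxE.
  by rewrite mulmx1.
have [->|zn0] := eqVneq (rip z z) 0; first by rewrite rip_ge0.
have zp : 0 < rip z z by rewrite lt_def zn0 rip_ge0.
by rewrite expr2 ler_pM2r.
Qed.

Lemma opnorm_le1_psd m (A : 'M[R[i]]_m) : opnorm A <= 1 -> psd (1%:M - A^t* *m A).
Proof.
move=> hA; split; first by rewrite adjmxB adjmx1 adjmxM trmxCK.
move=> v; rewrite mulmxBl mul1mx ripDr ripNr -mulmxA -rip_mulml subr_ge0.
have [v0|vn0] := eqVneq (rip v v) 0.
  by rewrite (rip_eq0 v0) mulmx0 rip0r.
have vp : 0 < rip v v by rewrite lt_def vn0 rip_ge0.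
set s := (Num.sqrt (rip v v))^-1.
have s2 : s ^+ 2 * rip v v = 1 by rewrite /s exprVn sqr_sqrtr ?rip_ge0 // mulVf.
have w1 : l2norm (s%:C *: v) = 1.
  by rewrite l2normE ripZr ripZl mulrA -expr2 s2 sqrtr1.
have := ub_le_sup (opnorm_has_ubound A) (imageP (fun v => l2norm (A *m v)) w1).
move=> /le_trans /(_ hA); rewrite l2normE -scalemxAr ripZr ripZl mulrA -expr2.
rewrite -[leRHS]sqrtr1 ler_sqrt //.
by rewrite -s2 ler_pM2l // exprn_gt0 // invr_gt0 sqrtr_gt0.
Qed.

End OperatorNorm.

(** * Fourier analysis in the Weyl basis *)

Section Fourier.
Variables (R : realType) (n : nat).
Local Notation T := (qbasis n).
Implicit Types (a b l : T) (S : (T * T)%type) (A B : qmx R n).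

Local Notation dimC := ((2 ^+ n)%R : R[i]).

Lemma dimC_neq0 : dimC != 0.
Proof. by rewrite expf_neq0 // pnatr_eq0. Qed.

Definition sgn b l : R[i] := \prod_i (-1) ^+ (b i * l i).

Lemma sgnC b l : sgn b l = sgn l b.
Proof. by apply: eq_bigr => i _; rewrite mulnC. Qed.

Lemma sgnDr b l m : sgn b (l + m) = sgn b l * sgn b m.
Proof.
rewrite /sgn -big_split; apply: eq_bigr => i _ /=; rewrite ffunE.
case: (b i) (l i) (m i) => [[|[|?]] //= ?] [[|[|?]] //= ?] [[|[|?]] //= ?];
  by rewrite /= ?mul0n ?mul1n ?expr0 ?expr1 ?mulr1 ?mul1r ?mulrNN ?mulr1.
Qed.

Lemma sgnDl b c l : sgn (b + c) l = sgn b l * sgn c l.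
Proof. by rewrite sgnC sgnDr !(sgnC l). Qed.

Lemma sgn0l l : sgn 0 l = 1.
Proof. by rewrite /sgn big1 // => i _; rewrite ffunE mul0n expr0. Qed.

Lemma opp_qbasis a : - a = a.
Proof.
apply/ffunP => i; rewrite ffunE; case: (a i) => [[|[|?]] //= ?]; exact/val_inj.
Qed.

Lemma add_qbasisK a b : a + b + b = a.
Proof. by rewrite -{2}(opp_qbasis b) addrK. Qed.

Lemma add_qbasisKl a b : b + a + b = a.
Proof. by rewrite (addrC b) add_qbasisK. Qed.

Lemma add_qbasisKr a b : b + (b + a) = a.
Proof. by rewrite addrC add_qbasisKl. Qed.

Lemma sgn_sqr b l : sgn b l * sgn b l = 1.
Proof. by rewrite -sgnDl -{2}(opp_qbasis b) subrr sgn0l. Qed.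

Lemma conj_sgn b l : Num.conj (sgn b l) = sgn b l.
Proof. by rewrite rmorph_prod; apply: eq_bigr => i _; rewrite rmorphXn rmorphN1. Qed.

Lemma sum_sgn l : \sum_b sgn b l = dimC *+ (l == 0).
Proof.
rewrite /sgn; have := bigA_distr_bigA (fun (i : 'I_n) (c : 'I_2) => (-1 : R[i]) ^+ (c * l i)).
move=> <-; under eq_bigr do rewrite !big_ord_recl big_ord0 /= addr0.
have [->|/eqP ln0] := eqVneq l 0.
  rewrite (eq_bigr (fun=> 2)) ?prodr_const ?card_ord // => i _.
  by rewrite ffunE !muln0 !expr0.
have [i li] : exists i, l i != 0.
  apply/existsP; apply: contra_notT ln0; rewrite negb_exists => /forallP h.
  by apply/ffunP => i; rewrite ffunE; apply/eqP; rewrite -[_ == _]negbK.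
rewrite (bigD1 i) //= (_ : _ + _ = 0) ?mul0r //.
by case: (l i) li => [[|[|?]] //= ?] _; rewrite expr0 /bump /= muln1 expr1 subrr.
Qed.

Lemma bitsK (k : 'I_#|{: T}|) : ofbits (bits k) = k.
Proof. exact: enum_valK. Qed.

Lemma sum_bits (V : nmodType) (F : 'I_#|{: T}| -> V) :
  \sum_k F k = \sum_(x : T) F (ofbits x).
Proof.
rewrite (reindex (@ofbits n)) //; apply: onW_bij.
by exists (@bits n); [exact: ofbitsK | exact: bitsK].
Qed.

(** Coefficient of [A] on the Weyl operator with entries
    [(k == l + S.1)%:R * sgn S.2 l]: along each shifted diagonal of [A] this is a
    Walsh-Hadamard transform. *)
Definition fc A S : R[i] :=
  dimC^-1 * \sum_l sgn S.2 l * A (ofbits (l + S.1)) (ofbits l).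

Lemma fcD A B S : fc (A + B) S = fc A S + fc B S.
Proof.
rewrite /fc -mulrDr -big_split; congr (_ * _); apply: eq_bigr => l _.
by rewrite mxE mulrDr.
Qed.

Lemma fcZ c A S : fc (c *: A) S = c * fc A S.
Proof.
rewrite /fc mulrCA; congr (_ * _); rewrite mulr_sumr; apply: eq_bigr => l _.
by rewrite mxE mulrCA.
Qed.

Lemma fcN A S : fc (- A) S = - fc A S.
Proof. by rewrite -scaleN1r fcZ mulN1r. Qed.

Lemma fcB A B S : fc (A - B) S = fc A S - fc B S.
Proof. by rewrite fcD fcN. Qed.

Lemma fc0 S : fc 0 S = 0.
Proof. by rewrite -(scale0r 0) fcZ mul0r. Qed.

Lemma fc_sum (I : Type) (r : seq I) (P : pred I) (F : I -> qmx R n) S :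
  fc (\sum_(i <- r | P i) F i) S = \sum_(i <- r | P i) fc (F i) S.
Proof. by elim/big_rec2: _ => [|i x y _ <-]; rewrite ?fc0 ?fcD. Qed.

Lemma addq_eq0 a b : (a + b == 0) = (a == b).
Proof. by rewrite -{1}(opp_qbasis b) subr_eq0. Qed.

Lemma sum_sgn_pick (F : T -> R[i]) b :
  \sum_c (\sum_l sgn l (b + c)) * F c = dimC * F b.
Proof.
rewrite (bigD1 b) //= sum_sgn addq_eq0 eqxx big1 ?addr0 // => c.
by rewrite eq_sym => /negPf bc; rewrite sum_sgn addq_eq0 bc mul0r.
Qed.

Lemma fc_inv A k l : A (ofbits k) (ofbits l) = \sum_b sgn b l * fc A (k + l, b).
Proof.
transitivity (dimC^-1 * \sum_m (\sum_b sgn b (l + m)) * A (ofbits (m + (k + l))) (ofbits m)).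
  by rewrite sum_sgn_pick mulKf ?dimC_neq0 // addrC add_qbasisK.
under eq_bigr do rewrite mulr_suml.
rewrite exchange_big mulr_sumr; apply: eq_bigr => b _.
rewrite /fc mulrCA; congr (_ * _); rewrite mulr_sumr; apply: eq_bigr => m _.
by rewrite sgnDr mulrA.
Qed.

Lemma fc_ext A B : (forall S, fc A S = fc B S) -> A = B.
Proof.
move=> AB; apply/matrixP => k l; rewrite -(bitsK k) -(bitsK l) !fc_inv.
by apply: eq_bigr => b _; rewrite AB.
Qed.

Definition synth (f : T * T -> R[i]) : qmx R n :=
  \matrix_(k, l) \sum_b sgn b (bits l) * f (bits k + bits l, b).

Lemma fc_synth f S : fc (synth f) S = f S.
Proof.
case: S => a b; rewrite /fc /=.
transitivity (dimC^-1 * \sum_c (\sum_l sgn l (b + c)) * f (a, c)); last first.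
  by rewrite sum_sgn_pick mulKf ?dimC_neq0.
congr (_ * _); under [RHS]eq_bigr do rewrite mulr_suml.
rewrite exchange_big; apply: eq_bigr => l _; rewrite mxE mulr_sumr.
apply: eq_bigr => c _; rewrite !ofbitsK mulrA sgnDr (sgnC b) (sgnC c).
by rewrite add_qbasisKl.
Qed.

(** Weyl operators multiply up to a sign, so a matrix product becomes a twisted
    convolution of the coefficients. *)
Lemma fc_mul A B S : fc (A *m B) S =
  \sum_(U : T * T) sgn U.2 (S.1 + U.1) * fc A U * fc B (S + U).
Proof.
case: S => a b; rewrite {1}/fc /=.
transitivity (dimC^-1 * \sum_l \sum_c \sum_d \sum_e
  sgn b l * (sgn d (l + c) * fc A (a + c, d)) * (sgn e l * fc B (c, e))).
  congr (_ * _); apply: eq_bigr => l _; rewrite mxE sum_bits mulr_sumr.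
  rewrite (reindex_inj (addrI l)); apply: eq_bigr => c _ /=.
  rewrite !fc_inv mulrA.
  have -> : l + a + (l + c) = a + c by rewrite (addrC l c) addrA -(addrA l a c) add_qbasisKl.
  rewrite add_qbasisKl.
  rewrite [X in X * _]mulr_sumr mulr_suml; apply: eq_bigr => d _.
  by rewrite mulr_sumr; apply: eq_bigr => e _.
rewrite exchange_big.
rewrite -(pair_big xpredT xpredT (fun u v => sgn v (a + u) * fc A (u, v) * fc B (a + u, b + v))) /=.
rewrite mulr_sumr [RHS](reindex_inj (addrI a)); apply: eq_bigr => c _ /=.
rewrite add_qbasisKr.
rewrite exchange_big mulr_sumr; apply: eq_bigr => d _.
rewrite exchange_big /=.
transitivity (dimC^-1 * \sum_e (\sum_l sgn l (b + d + e)) *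
    (sgn d c * fc A (a + c, d) * fc B (c, e))); last first.
  by rewrite sum_sgn_pick mulKf ?dimC_neq0.
congr (_ * _); apply: eq_bigr => e _; rewrite mulr_suml; apply: eq_bigr => l _.
rewrite !sgnDr !(sgnC l); ring.
Qed.

Lemma fc_tr A : fc A 0 = dimC^-1 * \tr A.
Proof.
rewrite /fc /mxtrace sum_bits; congr (_ * _); apply: eq_bigr => l _ /=.
by rewrite sgn0l mul1r addr0.
Qed.

Lemma fc_adj A S : fc (A^t*) S = sgn S.2 S.1 * Num.conj (fc A S).
Proof.
case: S => a b; rewrite /fc /= rmorphM fmorphV rmorphXn rmorph_nat mulrCA.
congr (_ * _); rewrite rmorph_sum mulr_sumr (reindex_inj (addIr a)).
apply: eq_bigr => l _; rewrite !mxE add_qbasisK sgnDr rmorphM /= conj_sgn; ring.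
Qed.

Lemma dimC_real : dimC = (2 ^+ n : R)%:C.
Proof. by rewrite rmorphXn rmorph_nat. Qed.

Lemma parseval A B :
  rip A B = 2 ^+ n * \sum_S complex.Re (Num.conj (fc A S) * fc B S).
Proof.
have -> : rip A B = complex.Re (dimC * fc (A^t* *m B) 0).
  by rewrite fc_tr mulVKf ?dimC_neq0.
rewrite dimC_real ReZ fc_mul Re_sum; congr (_ * _); apply: eq_bigr => S _.
by rewrite !add0r fc_adj mulrA sgn_sqr mul1r.
Qed.

Lemma setbit_id j (x : T) : setbit j (x j) x = x.
Proof. by apply/ffunP => i; rewrite !ffunE; case: eqP => [->|]. Qed.

Definition unitq j : T := [ffun i => if i == j then 1 else 0].

Lemma addq_unit j (l : T) : l + unitq j = setbit j (l j + 1) l.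
Proof. by apply/ffunP => i; rewrite !ffunE; case: eqP => [->|]; rewrite ?addr0. Qed.

Lemma sgn_unitq b j : sgn b (unitq j) = if b j == 0 then 1 else -1.
Proof.
rewrite /sgn (bigD1 j) //= ffunE eqxx big1 ?mulr1.
  by case: (b j) => [[|[|?]] //= ?]; rewrite /= ?mul0n ?muln1 ?expr0 ?expr1.
by move=> i /negPf ij; rewrite ffunE ij muln0 expr0.
Qed.

Lemma tauj_entry j A k l : tauj j A (ofbits k) (ofbits l) =
  if k j == l j then 2^-1 * (A (ofbits k) (ofbits l)
       + A (ofbits (k + unitq j)) (ofbits (l + unitq j))) else 0.
Proof.
rewrite mxE !ofbitsK; case: eqP => // kl; congr (_ * _).
rewrite !addq_unit -{2}(setbit_id j k) -{2}(setbit_id j l) kl.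
rewrite !big_ord_recl big_ord0 addr0.
case: (l j) => [[|[|?]] //= lt2].
  by congr (A (ofbits (setbit _ _ _)) (ofbits (setbit _ _ _)) +
            A (ofbits (setbit _ _ _)) (ofbits (setbit _ _ _))); apply/val_inj.
by rewrite addrC; congr (A (ofbits (setbit _ _ _)) (ofbits (setbit _ _ _)) +
            A (ofbits (setbit _ _ _)) (ofbits (setbit _ _ _))); apply/val_inj.
Qed.

(** Averaging over site [j] keeps the diagonals with no shift at [j] and, on
    them, averages over a flip of bit [j]; the flip acts on the coefficient by the
    sign [sgn S.2 (unitq j)]. *)
Lemma fc_tauj j A S : fc (tauj j A) S =
  (if (S.1 j == 0) && (S.2 j == 0) then 1 else 0) * fc A S.
Proof.
case: S => a b; rewrite /fc /= [RHS]mulrCA; congr (_ * _).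
have ajE (l : T) : ((l + a) j == l j) = (a j == 0).
  by rewrite ffunE -subr_eq0 addrC addKr.
case: eqP => [aj|/eqP/negPf aj]; last first.
  by rewrite mul0r big1 // => l _; rewrite tauj_entry ajE aj mulr0.
under eq_bigr do rewrite tauj_entry ajE aj eqxx.
transitivity (2^-1 * (1 + sgn b (unitq j)) * \sum_l sgn b l * A (ofbits (l + a)) (ofbits l)).
  rewrite mulrDr mulr1 mulrDl; under eq_bigr do rewrite mulrCA mulrDr mulrDr.
  rewrite big_split /= -mulr_sumr; congr (_ + _).
  rewrite -mulrA -mulr_sumr; congr (_ * _).
  rewrite mulr_sumr [RHS](reindex_inj (addIr (unitq j))); apply: eq_bigr => l _ /=.
  by rewrite sgnDr [RHS]mulrA [X in _ = X * _]mulrCA sgn_sqr mulr1 addrAC.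
congr (_ * _); rewrite sgn_unitq; case: eqP => _.
  by rewrite -[1 + 1]/(2%:R) mulVf ?pnatr_eq0.
by rewrite subrr mulr0.
Qed.

Definition mult (f : T * T -> R) A : qmx R n := synth (fun S => (f S)%:C * fc A S).

Lemma fc_mult f A S : fc (mult f A) S = (f S)%:C * fc A S.
Proof. exact: fc_synth. Qed.

Lemma mult_comp f g A : mult f (mult g A) = mult (fun S => f S * g S) A.
Proof. by apply: fc_ext => S; rewrite !fc_mult mulrA rmorphM. Qed.

Lemma eq_mult f g A : f =1 g -> mult f A = mult g A.
Proof. by move=> fg; apply: fc_ext => S; rewrite !fc_mult fg. Qed.

Lemma multD f A B : mult f (A + B) = mult f A + mult f B.
Proof. by apply: fc_ext => S; rewrite fcD !fc_mult fcD mulrDr. Qed.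

Lemma multB f A B : mult f (A - B) = mult f A - mult f B.
Proof. by apply: fc_ext => S; rewrite fcB !fc_mult fcB mulrBr. Qed.

Lemma mult_sum f (I : Type) (r : seq I) (P : pred I) (F : I -> qmx R n) :
  mult f (\sum_(i <- r | P i) F i) = \sum_(i <- r | P i) mult f (F i).
Proof.
apply: fc_ext => S; rewrite fc_sum fc_mult fc_sum mulr_sumr.
by apply: eq_bigr => i _; rewrite fc_mult.
Qed.

Lemma multZ f c A : mult f (c *: A) = c *: mult f A.
Proof. by apply: fc_ext => S; rewrite fcZ !fc_mult fcZ mulrCA. Qed.

Lemma mult_id A : mult (fun=> 1) A = A.
Proof. by apply: fc_ext => S; rewrite fc_mult mul1r. Qed.

Lemma mult_adj f A : (mult f A)^t* = mult f (A^t*).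
Proof.
by apply: fc_ext => S; rewrite fc_adj !fc_mult fc_adj rmorphM /= conjR mulrCA.
Qed.

Lemma rip_mult f A B : rip (mult f A) B = rip A (mult f B).
Proof.
rewrite !parseval; congr (_ * _); apply: eq_bigr => S _.
by rewrite !fc_mult rmorphM /= conjR -mulrA mulrCA.
Qed.

Lemma fc1 S : fc 1%:M S = (S == 0)%:R.
Proof.
case: S => a b; rewrite /fc /= -[(a, b) == 0]/((a == 0) && (b == 0)).
have [->|an0] := eqVneq a 0; last first.
  rewrite big1 ?mulr0 // => l _; rewrite mxE (can_eq (@ofbitsK n)).
  by rewrite -[X in _ == X]addr0 (inj_eq (addrI l)) (negPf an0) mulr0.
under eq_bigr do rewrite addr0 mxE eqxx mulr1 sgnC.
by rewrite sum_sgn /=; case: eqP; rewrite ?mulr1n ?mulVf ?dimC_neq0 // mulr0n mulr0.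
Qed.

Lemma mult1 f : mult f 1%:M = (f 0)%:C *: 1%:M.
Proof.
apply: fc_ext => S; rewrite fcZ fc_mult fc1; case: eqP => [->|] //.
by rewrite !mulr0.
Qed.

End Fourier.

(** * The Laplacian and its resolvent *)

Section GramIdentities.
Variables (R : realType) (m : nat).
Implicit Types A B D E L : 'M[R[i]]_m.

Lemma gramD A B :
  (A + B)^t* *m (A + B) = A^t* *m A + A^t* *m B + B^t* *m A + B^t* *m B.
Proof. by rewrite adjmxD mulmxDl !mulmxDr !addrA. Qed.

Lemma gramB A B :
  (A - B)^t* *m (A - B) = A^t* *m A - A^t* *m B - B^t* *m A + B^t* *m B.
Proof. by rewrite gramD adjmxN !mulmxN !mulNmx opprK. Qed.

Lemma gram_step (s : R) B L (U : 'M[R[i]]_m) :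
  (B + s%:C *: L)^t* *m (B + s%:C *: L) - B^t* *m B - s%:C *: U =
  (s%:C *: L)^t* *m (s%:C *: L) + s%:C *: (B^t* *m L + L^t* *m B - U).
Proof.
rewrite gramD !adjmxZ -!scalemxAl -!scalemxAr; move: (s%:C) => z.
move: (B^t* *m B) (B^t* *m L) (L^t* *m B) (L^t* *m L) => a b c d.
rewrite scalerBr scalerDr; move: (z *: b) (z *: c) (z *: (z *: d)) (z *: U) => x y w u.
by rewrite -(addrA a x) -(addrA a (x + y)) (addrC a) addrK -(addrA (x + y)) addrCA.
Qed.

Lemma psd_scaleB (s : R) A B : 0 <= s -> psd (B - A) ->
  psd (s%:C *: B - s%:C *: A).
Proof. by move=> s0 h; rewrite -scalerBr; exact: psdZ. Qed.

Lemma gram_site_gap D E (t : 'M[R[i]]_m) :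
  (E + D)^t* *m D + D^t* *m (E + D) - ((E + D)^t* *m (E + D) - (E^t* *m E + t)) =
  D^t* *m D + t.
Proof.
rewrite gramD adjmxD !mulmxDl !mulmxDr.
move: (E^t* *m E) (E^t* *m D) (D^t* *m E) (D^t* *m D) => a b c d.
by apply/matrixP => k l; rewrite !mxE; ring.
Qed.

End GramIdentities.

Section Laplacian.
Variables (R : realType) (n : nat).
Local Notation T := (qbasis n).
Implicit Types (s : R) (j : 'I_n) (S U : (T * T)%type) (A B X Y : qmx R n).

Definition active j S : bool := ~~ ((S.1 j == 0) && (S.2 j == 0)).

Definition wt S : nat := \sum_j active j S.

Lemma tauj_mult j A : tauj j A = mult (fun S => (~~ active j S)%:R) A.
Proof.
by apply: fc_ext => S; rewrite fc_mult fc_tauj /active negbK; case: ifP.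
Qed.

Lemma dj_mult j A : dj j A = mult (fun S => (active j S)%:R) A.
Proof.
apply: fc_ext => S; rewrite /dj tauj_mult fcB !fc_mult.
by case: (active j S); rewrite ?mul1r ?mul0r ?subr0 ?subrr.
Qed.

Definition lap A : qmx R n := \sum_j dj j A.

Lemma lap_mult A : lap A = mult (fun S => (wt S)%:R) A.
Proof.
apply: fc_ext => S; rewrite fc_sum fc_mult /wt natr_sum rmorph_sum mulr_suml.
by apply: eq_bigr => j _; rewrite dj_mult fc_mult.
Qed.

Lemma adj_tauj j A : (tauj j A)^t* = tauj j (A^t*).
Proof. by rewrite !tauj_mult mult_adj. Qed.

Lemma dj_mult_comm j f A : dj j (mult f A) = mult f (dj j A).
Proof. by rewrite !dj_mult !mult_comp; apply: eq_mult => S; rewrite mulrC. Qed.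

Lemma tauj_idem j A : tauj j (tauj j A) = tauj j A.
Proof.
rewrite !tauj_mult mult_comp; apply: eq_mult => S.
by case: (active j S); rewrite ?mulr0 ?mulr1.
Qed.

Lemma tauj_dj j A : tauj j (dj j A) = 0.
Proof. by rewrite /dj tauj_mult multB -!tauj_mult tauj_idem subrr. Qed.

Lemma tauj1 j : tauj j (1%:M : qmx R n) = 1%:M.
Proof. by rewrite tauj_mult mult1 /active !ffunE eqxx scale1r. Qed.

Lemma active_add j S U : ~~ active j U -> active j (S + U) = active j S.
Proof. by rewrite /active negbK => /andP[/eqP a /eqP b]; rewrite !ffunE a b !addr0. Qed.

Lemma taujD j A B : tauj j (A + B) = tauj j A + tauj j B.
Proof. by rewrite !tauj_mult multD. Qed.

(** [tauj j] is a conditional expectation: it is linear over its range.  In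
    Fourier space, adding a frequency that vanishes at site [j] does not change
    the other one there. *)
Lemma tauj_module_l j A B : tauj j (tauj j A *m B) = tauj j A *m tauj j B.
Proof.
apply: fc_ext => S; rewrite tauj_mult fc_mult !fc_mul mulr_sumr.
apply: eq_bigr => U _; rewrite !tauj_mult !fc_mult.
have [aU|aU] := boolP (active j U); first by rewrite !(mul0r, mulr0).
rewrite (active_add _ aU) /=; ring.
Qed.

Lemma tauj_module_r j A B : tauj j (A *m tauj j B) = tauj j A *m tauj j B.
Proof.
have := tauj_module_l j (B^t*) (A^t*); move/(congr1 (fun M => M^t*)).
by rewrite -!adj_tauj -!adjmxM -!adj_tauj !trmxCK.
Qed.

Lemma psd_conj m p (X : 'M[R[i]]_m) (B : 'M[R[i]]_(m, p)) : psd X -> psd (B^t* *m X *m B).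
Proof.
move=> [hX pX]; split; first by rewrite !adjmxM trmxCK hX mulmxA.
by move=> v; rewrite -!mulmxA -rip_mulml.
Qed.

(** The averaging map is a sum of conjugations, hence positive: it shifts bit
    [j] and compresses to the two values of that bit. *)
Lemma psd_tauj j X : psd X -> psd (tauj j X).
Proof.
move=> pX; pose K (c : 'I_2) (e : T) : qmx R n :=
  \matrix_(k, l) ((bits k == bits l + e) && (bits l j == c))%:R.
have KE c e k l : ((K c e)^t* *m X *m K c e) (ofbits k) (ofbits l) =
   ((k j == c) && (l j == c))%:R * X (ofbits (k + e)) (ofbits (l + e)).
  rewrite mxE sum_bits (bigD1 (l + e)) //= !mxE !ofbitsK eqxx /= [X in _ + X]big1.
    rewrite addr0 sum_bits (bigD1 (k + e)) //= !mxE !ofbitsK eqxx /= [X in _ + X]big1.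
      by rewrite addr0 rmorph_nat; do 2!case: (_ == c); rewrite /= ?(mul0r, mul1r, mulr0, mulr1).
    by move=> x /negPf xk; rewrite !mxE !ofbitsK xk /= rmorph0 mul0r.
  by move=> x /negPf xk; rewrite !mxE !ofbitsK xk /= mulr0.
have -> : tauj j X = (2^-1 : R)%:C *: \sum_c ((K c 0)^t* *m X *m K c 0 +
                        (K c (unitq j))^t* *m X *m K c (unitq j)).
  apply/matrixP => k l; rewrite -(bitsK k) -(bitsK l) tauj_entry mxE summxE.
  under eq_bigr do rewrite mxE !KE !addr0 -mulrDr.
  rewrite -mulr_suml; case: eqP => [->|kl].
    rewrite (bigD1 (bits l j)) //= eqxx big1 ?addr0 ?mul1r.
      by congr (_ * _); rewrite fmorphV rmorph_nat.
    by move=> c /negPf cl; rewrite eq_sym cl.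
  rewrite big1 ?mul0r ?mulr0 // => c _; case: eqP => // kc; case: eqP => // lc.
  by case: kl; rewrite kc lc.
apply: psdZ; first by rewrite invr_ge0.
by apply: psd_sum => c _; apply: psdD; exact: psd_conj.
Qed.

(** Twice the carre du champ of [lap], evaluated at [B]. *)
Definition carre B : qmx R n :=
  B^t* *m lap B + (lap B)^t* *m B - lap (B^t* *m B).

Lemma tauj_gramD j (E D : qmx R n) : tauj j E = E -> tauj j D = 0 ->
  tauj j ((E + D)^t* *m (E + D)) = E^t* *m E + tauj j (D^t* *m D).
Proof.
move=> tE tD; have tEj : tauj j (E^t*) = E^t* by rewrite -adj_tauj tE.
have tDj : tauj j (D^t*) = 0 by rewrite -adj_tauj tD trmx0 map_mx0.
have h1 : tauj j (E^t* *m E) = E^t* *m E.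
  by have := tauj_module_l j (E^t*) E; rewrite tEj tE.
have h2 : tauj j (E^t* *m D) = 0.
  by have := tauj_module_l j (E^t*) D; rewrite tEj tD mulmx0.
have h3 : tauj j (D^t* *m E) = 0.
  by have := tauj_module_r j (D^t*) E; rewrite tE tDj mul0mx.
rewrite adjmxD mulmxDl !mulmxDr.
move: (E^t* *m E) (E^t* *m D) (D^t* *m E) (D^t* *m D) h1 h2 h3 => a b c d h1 h2 h3.
by rewrite !taujD h1 h2 h3 addr0 add0r.
Qed.

(** Splitting [B] into its average and its fluctuation at site [j], the cross
    terms are killed by [tauj j] and only fluctuation squares survive. *)
Lemma carre_site j B :
  B^t* *m dj j B + (dj j B)^t* *m B - dj j (B^t* *m B) =
  (dj j B)^t* *m dj j B + tauj j ((dj j B)^t* *m dj j B).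
Proof.
have EB : B = tauj j B + dj j B by rewrite addrC subrK.
have := tauj_gramD (tauj_idem j B) (tauj_dj j B); rewrite -EB => tBB.
by rewrite {3}/dj tBB; have := gram_site_gap (dj j B) (tauj j B)
  (tauj j ((dj j B)^t* *m dj j B)); rewrite -EB.
Qed.

Lemma psd_carre_gap B : psd (carre B - gram (fun j => dj j B)).
Proof.
have -> : carre B - gram (fun j => dj j B) =
    \sum_j tauj j ((dj j B)^t* *m dj j B).
  rewrite /carre /gram /lap adjmx_sum mulmx_sumr mulmx_suml -big_split -sumrB -sumrB.
  by apply: eq_bigr => j _; rewrite carre_site addrC addKr.
by apply: psd_sum => j _; apply: psd_tauj; exact: psd_gram.
Qed.

Lemma psd_carre B : psd (carre B).
Proof.
by have := psdD (psd_carre_gap B) (psd_gram_sum (fun j => dj j B)); rewrite subrK.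
Qed.

Definition res_symb (s : R) S : R := (1 + s * (wt S)%:R)^-1.

Definition res s A : qmx R n := mult (res_symb s) A.

Lemma res_den_gt0 s S : 0 <= s -> 0 < 1 + s * (wt S)%:R.
Proof. by move=> s0; rewrite ltr_pwDl // mulr_ge0. Qed.

Lemma res_symb0 s : res_symb s 0 = 1.
Proof.
rewrite /res_symb /wt big1 ?mulr0 ?addr0 ?invr1 // => j _.
by rewrite /active !ffunE eqxx.
Qed.

Lemma res_eq s A : 0 <= s -> res s A + s%:C *: lap (res s A) = A.
Proof.
move=> s0; rewrite lap_mult mult_comp -[RHS]mult_id; apply: fc_ext => S.
rewrite fcD fcZ !fc_mult mulrA -rmorphM -mulrDl -rmorphD; congr (_%:C * _).
by rewrite /res_symb mulrA -[X in X + _]mul1r -mulrDl mulfV // gt_eqF ?res_den_gt0.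
Qed.

Lemma res_eqV s A : 0 <= s -> res s (A + s%:C *: lap A) = A.
Proof.
move=> s0; rewrite -[RHS](res_eq A s0) /res multD multZ !lap_mult !mult_comp.
by congr (_ + _ *: _); apply: eq_mult => S; rewrite mulrC.
Qed.

Lemma psd_hermB m c (X : 'M[R[i]]_m) : X^t* = X -> (forall k, c <= eigval X k) ->
  psd (X - c%:C *: 1%:M).
Proof.
move=> hX h; have Uu := spectral_unitarymx X.
rewrite -(specmx_const c Uu) {1}(spectral_thm hX) specmxB; apply: psd_specmx => k.
by rewrite subr_ge0.
Qed.

Lemma psd_eigval m (X : 'M[R[i]]_m) : X^t* = X -> (forall k, 0 <= eigval X k) -> psd X.
Proof. by move=> hX h; rewrite (spectral_thm hX); exact: psd_specmx. Qed.

(** Minimum principle: at a unit eigenvector for the least eigenvalue of [Y],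
    averaging cannot decrease the quadratic form, so [lap Y] is nonpositive
    there. *)
Lemma psd_res s X : 0 <= s -> psd X -> psd (res s X).
Proof.
move=> s0 [hX pX]; set Y := res s X.
have hY : Y^t* = Y by rewrite /Y /res mult_adj hX.
have XE : X = Y + s%:C *: lap Y by rewrite res_eq.
apply: psd_eigval => // k.
case: (arg_minP (eigval Y) (erefl : xpredT k)) => k0 _ min_k0.
apply: le_trans (min_k0 k isT); set c := eigval Y k0.
have pYc : psd (Y - c%:C *: 1%:M) by apply: psd_hermB => // i; exact: min_k0.
have Uu := spectral_unitarymx Y; pose v := evec (spectralmx Y) k0.
have vv : rip v v = 1 by exact: evec_unit.
have Yv : rip v (Y *m v) = c.
  by rewrite {1}(spectral_thm hY) (specmx_evec _ _ Uu) ripZr vv mulr1.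
have tv j : c <= rip v (tauj j Y *m v).
  have [_ /(_ v)] := psd_tauj j pYc.
  rewrite tauj_mult multB multZ -!tauj_mult tauj1 mulmxBl ripDr ripNr.
  by rewrite -scalemxAl mul1mx ripZr vv mulr1 subr_ge0.
have := pX v; rewrite XE mulmxDl ripDr Yv -scalemxAl ripZr.
rewrite /lap mulmx_suml rip_sumr => /le_trans; apply.
rewrite gerDl mulr_ge0_le0 // sumr_le0 // => j _.
by rewrite mulmxBl ripDr ripNr Yv subr_le0.
Qed.

Lemma lapB A B : lap (A - B) = lap A - lap B.
Proof. by rewrite !lap_mult multB. Qed.

Lemma carre_resolvent s (X B N : qmx R n) :
  X = B + s%:C *: lap B -> N + s%:C *: lap N = X^t* *m X ->
  (N - B^t* *m B) + s%:C *: lap (N - B^t* *m B) =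
  (s%:C *: lap B)^t* *m (s%:C *: lap B) + s%:C *: carre B.
Proof.
rewrite lapB /carre; move: (lap (B^t* *m B)) (lap N) (lap B) => u w L XE NE.
have -> : N - B^t* *m B + s%:C *: (w - u) = X^t* *m X - B^t* *m B - s%:C *: u.
  by rewrite -NE scalerBr addrACA -!addrA; congr (_ + _); rewrite addrCA.
by rewrite XE gram_step.
Qed.

(** Applying [1 + s lap], whose inverse is positive, to the gap leaves the square of
    [s lap (res s X)] plus a carre du champ. *)
Lemma kadison_schwarz_res s X : 0 <= s ->
  psd (res s (X^t* *m X) - (res s X)^t* *m res s X).
Proof.
move=> s0; have XE : X = res s X + s%:C *: lap (res s X) by rewrite res_eq.
have := res_eqV (res s (X^t* *m X) - (res s X)^t* *m res s X) s0.
rewrite (carre_resolvent XE (res_eq _ s0)) => <-; apply: psd_res => //.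
apply: psdD; first exact: psd_gram.
by apply: psdZ => //; exact: psd_carre.
Qed.

Lemma resB s A B : res s (A - B) = res s A - res s B.
Proof. exact: multB. Qed.

Lemma psd_gram_res (I : finType) s (X : I -> qmx R n) : 0 <= s ->
  psd (res s (gram X) - gram (fun i => res s (X i))).
Proof.
move=> s0; rewrite /gram /res mult_sum -sumrB; apply: psd_sum => i _.
exact: kadison_schwarz_res.
Qed.

Lemma dj_res j s A : dj j (res s A) = res s (dj j A).
Proof. exact: dj_mult_comm. Qed.

Lemma resD s A B : res s (A + B) = res s A + res s B.
Proof. exact: multD. Qed.

Lemma res_carre s A B : 0 <= s -> A = B + s%:C *: lap B ->
  1%:M - s%:C *: res s (carre B) =
  res s (1%:M - A^t* *m A) + (res s ((A - B)^t* *m (A - B)) + B^t* *m B).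
Proof.
move=> s0 AE; have res1 : res s 1%:M = (1%:M : qmx R n).
  by rewrite /res mult1 res_symb0 scale1r.
have sL : s%:C *: lap B = A - B by rewrite AE addrC addKr.
have hw : s%:C *: res s (lap (B^t* *m B)) = B^t* *m B - res s (B^t* *m B).
  by rewrite -[in X in X - _](res_eqV (B^t* *m B) s0) resD addrC addKr /res multZ.
have -> : s%:C *: res s (carre B) =
    res s (B^t* *m (s%:C *: lap B)) + res s ((s%:C *: lap B)^t* *m B)
    - s%:C *: res s (lap (B^t* *m B)).
  by rewrite /carre resB resD scalerBr scalerDr adjmxZ -!scalemxAl -!scalemxAr /res !multZ.
rewrite hw sL gramB adjmxB mulmxBl mulmxBr.
move: (A^t* *m A) (A^t* *m B) (B^t* *m A) (B^t* *m B) => a b c d.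
rewrite !(resB, resD) res1.
move: (res s a) (res s b) (res s c) (res s d) => ra rb rc rd.
move: (1%:M : qmx R n) => e.
by apply/matrixP => k l; rewrite !mxE; move: (e k l) (ra k l) (rb k l) (rc k l) (rd k l) (d k l) => *; ring.
Qed.

(** Smoothing turns an operator bound on [A] into a bound on the gradient: by
    Kadison-Schwarz the gradient of [res s B] is dominated by the smoothed carre
    du champ of [B = res s A], and [s lap] composed with [res s] is bounded. *)
Lemma gradient_bound s A : 0 <= s -> psd (1%:M - A^t* *m A) ->
  psd (1%:M - s%:C *: gram (fun j => dj j (res s (res s A)))).
Proof.
move=> s0 pA; have AE : A = res s A + s%:C *: lap (res s A) by rewrite res_eq.
have h1 : psd (res s (gram (fun j => dj j (res s A)))
               - gram (fun j => dj j (res s (res s A)))).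
  have := psd_gram_res (fun j => dj j (res s A)) s0.
  by rewrite (eq_gram (fun j => esym (dj_res j s (res s A)))).
have h2 : psd (res s (carre (res s A)) - res s (gram (fun j => dj j (res s A)))).
  by have := psd_res s0 (psd_carre_gap (res s A)); rewrite resB.
have h3 : psd (1%:M - s%:C *: res s (carre (res s A))).
  rewrite (res_carre s0 AE); apply: psdD; first exact: psd_res.
  exact: (psdD (psd_res s0 (psd_gram (A - res s A))) (psd_gram (res s A))).
exact: psd_trans (psd_scaleB s0 (psd_trans h1 h2)) h3.
Qed.

Definition fourier_weight A S : R := complex.Re (Num.conj (fc A S) * fc A S).

Lemma fourier_weight_ge0 A S : 0 <= fourier_weight A S.
Proof. by rewrite /fourier_weight Re_mulJ addr_ge0 // -expr2 sqr_ge0. Qed.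

Lemma rip_mult2 f g A :
  rip (mult f A) (mult g A) = 2 ^+ n * \sum_S f S * g S * fourier_weight A S.
Proof.
rewrite parseval; congr (_ * _); apply: eq_bigr => S _.
by rewrite !fc_mult rmorphM /= conjR mulrACA -rmorphM ReZ.
Qed.

Lemma sum_rip_dj f g A :
  \sum_j rip (dj j (mult f A)) (dj j (mult g A)) =
  2 ^+ n * \sum_S (wt S)%:R * (f S * g S) * fourier_weight A S.
Proof.
under eq_bigr do rewrite !dj_mult !mult_comp rip_mult2.
rewrite -mulr_sumr exchange_big; congr (_ * _); apply: eq_bigr => S _ /=.
rewrite /wt natr_sum !mulr_suml; apply: eq_bigr => j _.
by case: (active j S) => /=; ring.
Qed.

Lemma wt_eq0 S : (wt S == 0)%N = (S == 0).
Proof.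
rewrite /wt sum_nat_eq0; apply/forallP/eqP => [h|-> j]; last first.
  by rewrite /active !ffunE eqxx.
case: S h => a b h; have [-> ->] // : a = 0 /\ b = 0.
have z i : a i = 0 /\ b i = 0.
  by have := h i; rewrite /active /= eqb0 negbK => /andP[/eqP-> /eqP->].
by split; apply/ffunP => i; rewrite ffunE; have [] := z i.
Qed.

Lemma variance_fourier A : variance A = \sum_(S : T * T | S != 0) fourier_weight A S.
Proof.
rewrite varianceE (_ : A - _ = mult (fun S => (S != 0)%:R) A); last first.
  apply: fc_ext => S; rewrite fcB fc_mult -scalemx1 fcZ fc1 /tau -fc_tr.
  by case: eqP => [->|_]; rewrite /= ?mulr1 ?mulr0 ?mul0r ?mul1r ?subrr ?subr0.
rewrite rip_mult2 mulrA mulVf ?mul1r ?expf_neq0 ?pnatr_eq0 // [RHS]big_mkcond.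
by apply: eq_bigr => S _; case: eqP; rewrite /= ?mul0r ?mul1r.
Qed.

End Laplacian.

(** * The energy inequality at a fixed scale *)

Section EnergyInequality.
Variables (R : realType).

Lemma le_of_eq (x y : R) : x = y -> x <= y.
Proof. by move=> ->. Qed.

(** Young's inequality for [y * x]: the restriction [x <= 1] is what allows a power
    [p <= 2] of [y] together with the square of [x]. *)
Lemma young_pow (p x y : R) : 1 <= p -> p <= 2 -> 0 <= x -> x <= 1 -> 0 <= y ->
  y * x <= 2 * y `^ p + x ^+ 2 / 2.
Proof.
move=> p1 p2 x0 x1 y0; have yp0 := powR_ge0 y p.
have [yx|xy] := leP y (x / 2); first by nra.
have yp : 0 < y by lra.
suff h : x <= 2 * y `^ (p - 1).
  have -> : y `^ p = y * y `^ (p - 1) by rewrite mulr_powRB1 //; lra.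
  have : y * x <= y * (2 * y `^ (p - 1)) by rewrite ler_pM2l.
  have := sqr_ge0 x; lra.
have [y1|y1] := leP 1 y.
  have : y `^ 0 <= y `^ (p - 1) by apply: ler_powR => //; lra.
  rewrite powRr0; lra.
have : y `^ 1 <= y `^ (p - 1) by apply: ger_powR; [rewrite yp ltW | lra].
rewrite powRr1 //; lra.
Qed.

Lemma young_scaled (p s a d : R) : 1 <= p -> p <= 2 -> 0 < s -> 0 <= a ->
  0 <= d -> s * d <= 1 ->
  s * (a * Num.sqrt d) <= 2 * (a `^ p * s `^ (p / 2)) + s * d / 2.
Proof.
move=> p1 p2 s0 a0 d0 sd.
have rs := sqrtr_ge0 s; have rs2 : Num.sqrt s * Num.sqrt s = s.
  by rewrite -expr2 sqr_sqrtr // (ltW s0).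
have -> : s * (a * Num.sqrt d) = (a * Num.sqrt s) * (Num.sqrt s * Num.sqrt d).
  by rewrite -[in LHS]rs2; ring.
have -> : s * d = (Num.sqrt s * Num.sqrt d) ^+ 2.
  by rewrite exprMn !sqr_sqrtr // (ltW s0).
have -> : a `^ p * s `^ (p / 2) = (a * Num.sqrt s) `^ p.
  by rewrite powRM // -powR12_sqrt ?(ltW s0) // -powRrM [p / 2]mulrC.
have x1 : Num.sqrt s * Num.sqrt d <= 1.
  by rewrite -sqrtrM ?(ltW s0) // -[leRHS]sqrtr1 ler_wsqrtr.
by apply: young_pow => //; apply: mulr_ge0 => //; exact: sqrtr_ge0.
Qed.

Variable n : nat.
Local Notation T := (qbasis n).
Local Notation dim := ((2 ^+ n)%R : R).
Implicit Types (A : qmx R n) (S : (T * T)%type).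

Lemma res_symb_gt0 (s : R) S : 0 <= s -> 0 < res_symb s S.
Proof. by move=> s0; rewrite invr_gt0 res_den_gt0. Qed.

Lemma res_symb_le1 (s : R) S : 0 <= s -> res_symb s S <= 1.
Proof. by move=> s0; rewrite invf_le1 ?res_den_gt0 // lerDl mulr_ge0. Qed.

Lemma res2E (s : R) A : res s (res s A) = mult (fun S => res_symb s S ^+ 2) A.
Proof. by rewrite /res mult_comp; apply: eq_mult => S; rewrite expr2. Qed.

(** Fourier form of the pairing computed in [smoothed_pairing]. *)
Definition smoothed (s : R) A : R :=
  \sum_(S : T * T) (wt S)%:R * res_symb s S ^+ 2 * fourier_weight A S.

Lemma smoothed_pairing (s : R) A :
  \sum_j rip (dj j A) (dj j (res s (res s A))) = dim * smoothed s A.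
Proof.
have := sum_rip_dj (fun=> 1) (fun S => res_symb s S ^+ 2) A.
by rewrite mult_id -res2E => ->; congr (_ * _); apply: eq_bigr => S _; rewrite mul1r.
Qed.

Lemma smoothed_grad_le (s : R) A : 0 <= s ->
  \sum_j rip (dj j (res s (res s A))) (dj j (res s (res s A))) <= dim * smoothed s A.
Proof.
move=> s0; rewrite res2E sum_rip_dj ler_pM2l ?dim_gt0 //; apply: ler_sum => S _.
apply: ler_wpM2r; first exact: fourier_weight_ge0.
apply: ler_wpM2l => //; have h := res_symb_le1 S s0; have h0 := res_symb_gt0 S s0.
by rewrite ger_pMr ?exprn_gt0 // exprn_ile1 // ltW.
Qed.

(** The pairing of the gradient of [A] with that of its smoothing is estimated
    by duality; the smoothed gradient is small in operator norm and its square
    norm is at most the pairing itself, so Young's inequality absorbs it. *)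
Lemma energy_bound (p s : R) A : 1 <= p -> p <= 2 -> 0 < s ->
  psd (1%:M - A^t* *m A) ->
  s * smoothed s A <= 4 * s `^ (p / 2) * energy p A.
Proof.
move=> p1 p2 s0 pA; have s0' := ltW s0.
set X := fun j => dj j A; set Y := fun j => dj j (res s (res s A)).
set U := spectralmx (gram X); have Uu : U \is unitarymx by exact: spectral_unitarymx.
have dY k : s * dens Y U k <= 1.
  rewrite -ler_pdivlMl // mulr1; apply: (dens_le _ Uu).
  have si0 : 0 <= s^-1 by rewrite invr_ge0.
  have := psdZ si0 (gradient_bound s0' pA).
  rewrite scalerBr scalerA -rmorphM (mulVf (lt0r_neq0 s0)) scale1r.
  exact.
(* Young's inequality at each eigenvector, the second term being absorbed below *)
have key : s * (\sum_j rip (X j) (Y j)) <=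
    2 * s `^ (p / 2) * (\sum_k sing X k `^ p) + s / 2 * (\sum_k dens Y U k).
  apply: le_trans (ler_wpM2l s0' (duality X Y)) _.
  rewrite !mulr_sumr -big_split; apply: ler_sum => k _ /=.
  apply: le_trans (young_scaled p1 p2 s0 (sing_ge0 X k) (dens_ge0 Y U k) (dY k)) _.
  by apply: le_of_eq; ring.
rewrite smoothed_pairing sum_dens // in key.
have := smoothed_grad_le A s0'; rewrite -/Y => gY.
have eE : \sum_k sing X k `^ p = dim * energy p A.
  rewrite energyE ?mulrA ?mulfV ?mul1r ?gt_eqF ?dim_gt0 //; lra.
rewrite eE in key.
have {}gY := ler_wpM2l (ltW (divr_gt0 s0 (ltr0Sn R 1))) gY.
have {gY}key := le_trans key (lerD (lexx _) gY).
rewrite -(ler_pM2l (dim_gt0 R n)); move: key.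
move: (energy p A) (smoothed s A) (s `^ (p / 2)) dim => e w t d; lra.
Qed.

End EnergyInequality.

(** * A convolution inequality on the frequency group *)

Section Convolution.
Variable R : realType.

Lemma sum_sqr_ge0 (I : finType) (x : I -> R) : 0 <= \sum_i x i ^+ 2.
Proof. by apply: sumr_ge0 => i _; exact: sqr_ge0. Qed.

Lemma le_sqr_nneg (x y : R) : 0 <= y -> x ^+ 2 <= y ^+ 2 -> x <= y.
Proof. by move=> y0 h; rewrite leNgt; apply/negP => yx; nra. Qed.

Lemma minkowski_sqr (I J : finType) (c : I -> J -> R) (N : I -> R) :
  (forall i, 0 <= N i) -> (forall i, \sum_j c i j ^+ 2 <= N i ^+ 2) ->
  \sum_j (\sum_i c i j) ^+ 2 <= (\sum_i N i) ^+ 2.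
Proof.
move=> N0 cN; rewrite expr2 mulr_suml.
under eq_bigr do rewrite expr2 mulr_suml.
rewrite exchange_big; apply: ler_sum => i _.
under eq_bigr do rewrite mulr_sumr.
rewrite exchange_big mulr_sumr; apply: ler_sum => k _.
have : (\sum_j c i j * c k j) ^+ 2 <= (N i * N k) ^+ 2.
  apply: le_trans (cauchy_sum _ _) _; rewrite exprMn.
  by apply: ler_pM; rewrite ?sum_sqr_ge0.
exact: le_sqr_nneg (mulr_ge0 (N0 i) (N0 k)).
Qed.

(** Applied with [y = z], this is a bound of a fourth moment by the square of a
    second moment; the bilinear form is the one that tensorizes. *)
Definition contractive (G : finType) (op : G -> G -> G) (w : G -> R) : Prop :=
  (forall s, 0 <= w s) /\
  forall y z : G -> R, (forall s, 0 <= y s) -> (forall s, 0 <= z s) ->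
  \sum_u (\sum_s w s * w (op u s) * (y s * z (op u s))) ^+ 2 <=
  (\sum_s y s ^+ 2) * (\sum_s z s ^+ 2).

(** Fix the [G] components of the frequencies: the inner sums are convolutions on
    [H], bounded by the [H] hypothesis.  Minkowski's inequality sums these bounds
    and leaves a convolution on [G] of the partial l2 norms. *)
Lemma contractive_prod (G H : finType) op op' (w : G -> R) (w' : H -> R) :
  contractive op w -> contractive op' w' ->
  contractive (fun u s : G * H => (op u.1 s.1, op' u.2 s.2))
    (fun s => w s.1 * w' s.2).
Proof.
move=> [w0 cG] [w'0 cH]; split=> [s|y z y0 z0]; first by rewrite mulr_ge0.
pose c u s v := w s * w (op u s) *
  \sum_t w' t * w' (op' v t) * (y (s, t) * z (op u s, op' v t)).
pose Y s := Num.sqrt (\sum_t y (s, t) ^+ 2).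
pose Z s := Num.sqrt (\sum_t z (s, t) ^+ 2).
have Y2 s : Y s ^+ 2 = \sum_t y (s, t) ^+ 2 by rewrite sqr_sqrtr // sum_sqr_ge0.
have Z2 s : Z s ^+ 2 = \sum_t z (s, t) ^+ 2 by rewrite sqr_sqrtr // sum_sqr_ge0.
have sumY : \sum_s Y s ^+ 2 = \sum_s y s ^+ 2.
  by under eq_bigr do rewrite Y2; rewrite pair_bigA; apply: eq_bigr => -[].
have sumZ : \sum_s Z s ^+ 2 = \sum_s z s ^+ 2.
  by under eq_bigr do rewrite Z2; rewrite pair_bigA; apply: eq_bigr => -[].
rewrite -sumY -sumZ.
apply: le_trans (cG Y Z (fun=> sqrtr_ge0 _) (fun=> sqrtr_ge0 _)).
rewrite -(pair_bigA _ (fun u v => (\sum_s w s.1 * w' s.2 *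
  (w (op u s.1) * w' (op' v s.2)) * (y s * z (op u s.1, op' v s.2))) ^+ 2)) /=.
apply: ler_sum => u _.
have -> : \sum_v (\sum_s w s.1 * w' s.2 *
  (w (op u s.1) * w' (op' v s.2)) * (y s * z (op u s.1, op' v s.2))) ^+ 2 =
  \sum_v (\sum_s c u s v) ^+ 2.
  apply: eq_bigr => v _; congr (_ ^+ 2).
  transitivity (\sum_s \sum_t (w s * w' t *
    (w (op u s) * w' (op' v t)) * (y (s, t) * z (op u s, op' v t)))).
    by rewrite pair_bigA; apply: eq_bigr => -[].
  by apply: eq_bigr => s _; rewrite /c mulr_sumr; apply: eq_bigr => t _; ring.
apply: minkowski_sqr => s.
  by rewrite !mulr_ge0 // sqrtr_ge0.
rewrite /c; under eq_bigr do rewrite exprMn.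
rewrite -mulr_sumr [leRHS]exprMn; apply: ler_wpM2l; first exact: sqr_ge0.
rewrite exprMn Y2 Z2; exact: (cH (fun t => y (s, t)) (fun t => z (op u s, t))).
Qed.

Lemma contractive_transport (G H : finType) op op' (w : G -> R) (w' : H -> R)
    (f : G -> H) (g : H -> G) : cancel f g -> cancel g f ->
  {morph f : x y / op x y >-> op' x y} -> w =1 w' \o f ->
  contractive op' w' -> contractive op w.
Proof.
move=> fK gK fM wf [w'0 cH]; split=> [s|y z y0 z0]; first by rewrite wf /=.
have fb : {on xpredT, bijective f} by apply: onW_bij; exists g.
have := cH (y \o g) (z \o g) (fun=> y0 _) (fun=> z0 _).
rewrite !(reindex f) //=.
under [X in _ <= X * _]eq_bigr do rewrite fK.
under [X in _ <= _ * X]eq_bigr do rewrite fK.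
apply: le_trans; apply: ler_sum => u _; rewrite (reindex f) //=.
rewrite le_eqVlt; apply/orP; left; apply/eqP; congr (_ ^+ 2); apply: eq_bigr => s _.
by rewrite !wf /= -fM !fK.
Qed.

Lemma contractive_bit :
  contractive (fun u s : 'I_2 => u + s) (fun s : 'I_2 => if s == 0 then 1 else 2^-1 : R).
Proof.
split=> [s|y z y0 z0]; first by case: ifP => _ //; rewrite invr_ge0.
rewrite !big_ord_recl !big_ord0 /=.
have e1 : lift ord0 ord0 = 1 :> 'I_2 by apply/val_inj.
rewrite e1 (_ : ord0 = 0) // !add0r (_ : 1 + 1 = 0 :> 'I_2) ?addr0; last exact/val_inj.
move: (y 0) (y 1) (z 0) (z 1) (y0 0) (y0 1) (z0 0) (z0 1) => a b c d a0 b0 c0 d0.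
have : 0 <= (a * d - b * c) ^+ 2 by exact: sqr_ge0.
have : 0 <= (b * d) ^+ 2 by exact: sqr_ge0.
have : 0 <= (a * d) ^+ 2 by exact: sqr_ge0.
have : 0 <= (b * c) ^+ 2 by exact: sqr_ge0.
move=> h1 h2 h3 h4; nra.
Qed.

Definition bitw n (x : qbasis n) : R := \prod_i (if x i == 0 then 1 else 2^-1).

Lemma contractive_bitw n : contractive (fun u s : qbasis n => u + s) (@bitw n).
Proof.
elim: n => [|n IH].
  have all0 (x : qbasis 0) : x = 0 by apply/ffunP; case.
  have sum0 (F : qbasis 0 -> R) : \sum_x F x = F 0.
    rewrite (eq_bigr (fun=> F 0)) => [|x _]; last by rewrite (all0 x).
    by rewrite sumr_const card_qbasis expn0 mulr1n.
  split=> [s|y z y0 z0]; first by rewrite /bitw big_ord0.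
  by rewrite !sum0 (all0 (_ + _)) /bitw !big_ord0 !mul1r exprMn.
pose f (x : qbasis n.+1) : 'I_2 * qbasis n := (x ord0, [ffun i => x (lift ord0 i)]).
pose g (p : 'I_2 * qbasis n) : qbasis n.+1 :=
  [ffun i => if unlift ord0 i is Some j then p.2 j else p.1].
apply: (@contractive_transport _ _ _ _ _ _ f g _ _ _ _ (contractive_prod contractive_bit IH)).
- by move=> x; apply/ffunP => i; rewrite ffunE; case: unliftP => [j|] -> //=; rewrite ffunE.
- move=> [c x]; congr (_, _); first by rewrite ffunE unlift_none.
  by apply/ffunP => i; rewrite !ffunE liftK.
- by move=> x y; congr (_, _); rewrite ?ffunE //; apply/ffunP => i; rewrite !ffunE.
- by move=> x; rewrite /bitw big_ord_recl /=; congr (_ * _); apply: eq_bigr => i _; rewrite ffunE.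
Qed.

End Convolution.

(** * Hypercontractivity for matrices *)

Section Hypercontractivity.
Variables (R : realType) (n : nat).
Local Notation T := (qbasis n).
Local Notation dim := ((2 ^+ n)%R : R).
Implicit Types (A X Y : qmx R n) (S U : (T * T)%type).

(** A site carrying both a shift and a sign is damped twice.  This is stronger
    noise than the depolarizing one, but it is a product over bits, so that its
    contractivity reduces to a single bit. *)
Definition noise_symb S : R := bitw R S.1 * bitw R S.2.

Definition noise X : qmx R n := mult noise_symb X.

Lemma contractive_noise : contractive (fun U S : T * T => U + S) noise_symb.
Proof. exact: (contractive_prod (contractive_bitw R n) (contractive_bitw R n)). Qed.

Lemma noise_symb_ge S : (4^-1 : R) ^+ wt S <= noise_symb S.
Proof.
rewrite /noise_symb /bitw -big_split /wt -prodrXr; apply: ler_prod => i _.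
rewrite exprn_ge0 ?invr_ge0 //= /active.
by case: eqP => _; case: eqP => _ /=; rewrite ?expr0 ?expr1; lra.
Qed.

Definition cabs (z : R[i]) : R := complex.Re `|z|.

Lemma cabs_ge0 z : 0 <= cabs z.
Proof. by rewrite /cabs normc_def sqrtr_ge0. Qed.

Lemma cabsM z w : cabs (z * w) = cabs z * cabs w.
Proof. by rewrite /cabs normrM !normc_def -rmorphM. Qed.

Lemma cabsM5 a b c d e : cabs (a * (b * c) * (d * e)) =
  cabs a * (cabs b * cabs c) * (cabs d * cabs e).
Proof. by rewrite !cabsM. Qed.

Lemma cabs_sum (I : finType) (F : I -> R[i]) :
  cabs (\sum_i F i) <= \sum_i cabs (F i).
Proof.
rewrite /cabs -Re_sum; have := ler_norm_sum (index_enum I) F xpredT.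
by rewrite lecE => /andP[_].
Qed.

Lemma sqr_cabs z : cabs z ^+ 2 = complex.Re (Num.conj z * z).
Proof.
rewrite Re_mulJ /cabs normc_def /= sqr_sqrtr ?addr_ge0 ?sqr_ge0 //.
Qed.

Lemma cabs_sgn (b l : T) : cabs (sgn R b l) = 1.
Proof.
have : cabs (sgn R b l) ^+ 2 = 1 by rewrite sqr_cabs conj_sgn sgn_sqr.
by move/eqP; rewrite sqrp_eq1 ?cabs_ge0 // => /eqP.
Qed.

(** A product of matrices is a twisted convolution of their Fourier
    coefficients; taking moduli removes the phases and reduces the fourth moment
    inequality to the commutative convolution bound. *)
Lemma noise_product X Y :
  rip (noise X *m noise Y) (noise X *m noise Y) * dim <= rip X X * rip Y Y.
Proof.
have parsX Z : rip Z Z = dim * \sum_(S : T * T) cabs (fc Z S) ^+ 2.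
  by rewrite parseval; congr (_ * _); apply: eq_bigr => S _; exact: esym (sqr_cabs _).
rewrite !parsX mulrAC -[leRHS]mulrACA ler_pM2l; last by rewrite mulr_gt0 // dim_gt0.
have [w0 cw] := contractive_noise.
apply: le_trans (cw (fun S => cabs (fc X S)) (fun S => cabs (fc Y S))
  (fun=> cabs_ge0 _) (fun=> cabs_ge0 _)).
apply: ler_sum => S _.
have h : cabs (fc (noise X *m noise Y) S) <=
    \sum_U noise_symb U * noise_symb (S + U) * (cabs (fc X U) * cabs (fc Y (S + U))).
  rewrite fc_mul; apply: le_trans (cabs_sum _) _.
  apply: ler_sum => U _; rewrite !fc_mult cabsM5 cabs_sgn mul1r.
  have cR (a : R) : 0 <= a -> cabs a%:C = a.
    by move=> a0; rewrite /cabs normc_def /= expr0n addr0 sqrtr_sqr ger0_norm.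
  by rewrite !cR // mulrACA.
by rewrite ler_sqr ?nnegrE ?cabs_ge0 // (le_trans (cabs_ge0 _) h).
Qed.

Lemma rip_sum_gram (I : finType) (M : I -> qmx R n) (N : I -> R) :
  (forall i, 0 <= N i) -> (forall i, rip (M i) (M i) <= N i ^+ 2) ->
  rip (\sum_i M i) (\sum_i M i) <= (\sum_i N i) ^+ 2.
Proof.
move=> N0 MN; rewrite rip_suml expr2 mulr_suml; apply: ler_sum => i _.
rewrite rip_sumr mulr_sumr; apply: ler_sum => k _.
apply: le_sqr_nneg; first by rewrite mulr_ge0.
apply: le_trans (cauchy_rip1 _ _) _; rewrite exprMn.
by apply: ler_pM; rewrite ?rip_ge0.
Qed.

(** The fourth moment of a column is the square of the 2-norm of its [gram], so
    the triangle inequality for the 2-norm reduces it to single entries. *)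
Lemma noise_gram (I : finType) (X : I -> qmx R n) :
  rip (gram (fun i => noise (X i))) (gram (fun i => noise (X i))) * dim <=
  (\sum_i rip (X i) (X i)) ^+ 2.
Proof.
rewrite -ler_pdivlMr ?dim_gt0 //.
have rd : 0 < Num.sqrt dim by rewrite sqrtr_gt0 dim_gt0.
have rd2 : Num.sqrt dim ^+ 2 = dim by rewrite sqr_sqrtr // ltW // dim_gt0.
have -> : (\sum_i rip (X i) (X i)) ^+ 2 / dim =
    (\sum_i rip (X i) (X i) / Num.sqrt dim) ^+ 2.
  by rewrite -mulr_suml expr_div_n rd2.
apply: rip_sum_gram => i; first by rewrite divr_ge0 ?rip_ge0 // ltW.
rewrite expr_div_n rd2 ler_pdivlMr ?dim_gt0 //.
have := noise_product ((X i)^t*) (X i).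
by rewrite /noise -mult_adj rip_adj -expr2.
Qed.

End Hypercontractivity.

(** * The noisy gradient *)

Section GradientContraction.
Variables (R : realType) (n : nat).
Local Notation T := (qbasis n).
Local Notation dim := ((2 ^+ n)%R : R).
Implicit Types (s : R) (A B : qmx R n).

Lemma gram_mulr (I : finType) m (X : I -> 'M[R[i]]_m) (V : 'M[R[i]]_m) :
  gram (fun i => X i *m V) = V^t* *m gram X *m V.
Proof.
rewrite /gram mulmx_sumr mulmx_suml; apply: eq_bigr => i _.
by rewrite adjmxM !mulmxA.
Qed.

Lemma gram_spectral (I : finType) m (X : I -> 'M[R[i]]_m) :
  gram X = specmx (spectralmx (gram X)) (fun k => sing X k ^+ 2).
Proof.
have [h _] := psd_gram_sum X; rewrite {1}(spectral_thm h).
by apply: eq_specmx => k; rewrite sqr_sing.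
Qed.

Lemma mulVV (x : R) : x^-1 * x ^+ 2 = x.
Proof. by have [->|x0] := eqVneq x 0; [rewrite expr0n mulr0 | rewrite expr2 mulKf]. Qed.

(** The polar part of [X]: with the convention [0^-1 = 0] the candidate
    [X i * |X|^-1] is a partial isometry and attains the trace norm of [X]. *)
Lemma polar_part (I : finType) m (X : I -> 'M[R[i]]_m) :
  exists2 Z : I -> 'M[R[i]]_m, psd (1%:M - gram Z) &
    \sum_i rip (X i) (Z i) = \sum_k sing X k.
Proof.
set U := spectralmx (gram X); have Uu : U \is unitarymx by exact: spectral_unitarymx.
set V := specmx U (fun k => (sing X k)^-1).
have hV : V^t* = V by exact: adj_specmx.
exists (fun i => X i *m V).
  rewrite gram_mulr hV gram_spectral -/U /V !(specmxM _ _ Uu) -(specmx1 Uu) specmxB.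
  apply: psd_specmx => k; rewrite mulVV.
  by have [->|x0] := eqVneq (sing X k) 0; rewrite ?mul0r ?subr0 // mulfV // subrr.
have -> : \sum_i rip (X i) (X i *m V) = complex.Re (\tr (gram X *m V)).
  transitivity (rip 1%:M (gram X *m V)); last by rewrite /rip adjmx1 mul1mx.
  rewrite mulmx_suml rip_sumr; apply: eq_bigr => i _.
  by rewrite -mulmxA -rip_mulml mulmx1.
rewrite gram_spectral -/U /V (specmxM _ _ Uu) (tr_specmx _ Uu).
by apply: eq_bigr => k _; rewrite mulrC mulVV.
Qed.

Lemma psd_res_gram_le1 (I : finType) s (Z : I -> qmx R n) : 0 <= s ->
  psd (1%:M - gram Z) -> psd (1%:M - gram (fun i => res s (Z i))).
Proof.
move=> s0 pZ; apply: psd_trans (psd_gram_res Z s0) _.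
have -> : 1%:M - res s (gram Z) = res s (1%:M - gram Z).
  by rewrite resB /res mult1 res_symb0 scale1r.
exact: psd_res.
Qed.

(** By duality with the polar part: smoothing is self-adjoint and preserves the
    unit ball of the dual norm, so it contracts the trace norm of the gradient. *)
Lemma sum_sing_smoothed s A : 0 <= s ->
  \sum_k sing (fun j => dj j (res s (res s A))) k <= \sum_k sing (fun j => dj j A) k.
Proof.
move=> s0; have [Z pZ <-] := polar_part (fun j => dj j (res s (res s A))).
have -> : \sum_j rip (dj j (res s (res s A))) (Z j) =
          \sum_j rip (dj j A) (res s (res s (Z j))).
  by apply: eq_bigr => j _; rewrite !dj_res /res !rip_mult.
apply: le_trans (duality _ _) _; apply: ler_sum => k _.
rewrite -[leRHS]mulr1; apply: ler_wpM2l; first exact: sing_ge0.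
rewrite -[leRHS]sqrtr1 ler_wsqrtr //; apply: dens_le; first exact: spectral_unitarymx.
rewrite scale1r; exact: psd_res_gram_le1 s0 (psd_res_gram_le1 s0 pZ).
Qed.

(** Cauchy-Schwarz with weights [g]; a second application, to the sum on the
    right, interpolates between the 1-norm and the 2-norm of [g]. *)
Lemma weighted_cauchy (I : finType) (g d : I -> R) (y : R) :
  (forall k, 0 <= g k) -> (forall k, 0 <= d k) -> 0 <= y ->
  y <= \sum_k g k * Num.sqrt (d k) ->
  y ^+ 2 <= (\sum_k g k) * (\sum_k g k * d k).
Proof.
move=> g0 d0 y0 h.
have h1 : y ^+ 2 <= (\sum_k g k * Num.sqrt (d k)) ^+ 2.
  by rewrite ler_sqr ?nnegrE // (le_trans y0 h).
apply: le_trans h1 _.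
have := cauchy_sum (fun k => Num.sqrt (g k)) (fun k => Num.sqrt (g k) * Num.sqrt (d k)).
under eq_bigr do rewrite mulrA -expr2 sqr_sqrtr //.
under [X in _ <= X * _]eq_bigr do rewrite sqr_sqrtr //.
by under [X in _ <= _ * X]eq_bigr do rewrite exprMn !sqr_sqrtr //.
Qed.

(** Moving all the noise to one side, duality bounds [y] by the singular values of
    [g] against the densities of the twice noisy family.  By [noise_gram] the
    fourth moment of that family is at most [y ^+ 2] up to normalization, so that
    [y] appears on both sides and can be divided out. *)
Lemma noisy_gradient (I : finType) (g : I -> qmx R n) (y : R) :
  y = \sum_i rip (noise (g i)) (noise (g i)) ->
  dim * y ^+ 2 <= (\sum_k sing g k) ^+ 2 * (\sum_k sing g k ^+ 2).
Proof.
move=> yE; have y0 : 0 <= y by rewrite yE sumr_ge0 // => i _; exact: rip_ge0.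
set Y := fun i => noise (noise (g i)); set U := spectralmx (gram g).
have Uu : U \is unitarymx by exact: spectral_unitarymx.
have d0 := ltW (dim_gt0 R n).
have h1 : y <= \sum_k sing g k * Num.sqrt (dens Y U k).
  rewrite yE; apply: le_trans (duality g Y); rewrite le_eqVlt; apply/orP; left.
  by apply/eqP; apply: eq_bigr => i _; rewrite [LHS]rip_mult.
have h2 := weighted_cauchy (sing_ge0 g) (dens_ge0 Y U) y0 h1.
have h3 : (\sum_k sing g k * dens Y U k) ^+ 2 * dim <=
    (\sum_k sing g k ^+ 2) * y ^+ 2.
  apply: le_trans (ler_wpM2r d0 (cauchy_sum _ _)) _.
  rewrite -mulrA; apply: ler_wpM2l; first exact: sum_sqr_ge0.
  apply: le_trans (ler_wpM2r d0 (sum_dens_sqr Y Uu)) _.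
  by rewrite yE; exact: noise_gram.
move: h2 h3; set t := \sum_k sing g k * dens Y U k.
have t0 : 0 <= t by apply: sumr_ge0 => k _; rewrite mulr_ge0 ?sing_ge0 ?dens_ge0.
have a0 : 0 <= \sum_k sing g k by apply: sumr_ge0 => k _; exact: sing_ge0.
have b0 : 0 <= \sum_k sing g k ^+ 2 by exact: sum_sqr_ge0.
move: (\sum_k sing g k) (\sum_k sing g k ^+ 2) t t0 a0 b0 => a b t t0 a0 b0 h2 h3.
have [->|yn0] := eqVneq y 0; first by rewrite expr0n mulr0 mulr_ge0 // exprn_ge0.
have yp : 0 < y ^+ 2 by rewrite exprn_gt0 // lt_def yn0.
rewrite -(ler_pM2r yp).
have h4 : (y ^+ 2) ^+ 2 <= (a * t) ^+ 2 by rewrite ler_sqr ?nnegrE ?mulr_ge0 // ltW.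
have := ler_wpM2l (sqr_ge0 a) h3; have := ler_wpM2l d0 h4.
rewrite exprMn; move: dim => d; lra.
Qed.

(** Normalized square norm of the noisy gradient of [res 1 (res 1 A)], in
    Fourier form. *)
Definition noisy A : R :=
  \sum_(S : T * T) (wt S)%:R * (noise_symb R S * res_symb 1 S ^+ 2) ^+ 2 * fourier_weight A S.

(** Interpolation between the 1-norm of the smoothed gradient, which smoothing
    does not increase, and its 2-norm, which [energy_bound] at scale 1 controls by
    the energy of any exponent [p]. *)
Lemma noisy_bound A (p : R) : 1 <= p -> p <= 2 -> psd (1%:M - A^t* *m A) ->
  noisy A ^+ 2 <= 4 * energy 1 A ^+ 2 * energy p A.
Proof.
move=> p1 p2 pA; set g := fun j => dj j (res 1 (res 1 A)).
have yE : dim * noisy A = \sum_j rip (noise (g j)) (noise (g j)).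
  rewrite /g res2E /noise; under eq_bigr do rewrite -!dj_mult_comm mult_comp.
  by rewrite sum_rip_dj.
have := noisy_gradient yE; have d0 := dim_gt0 R n.
have l01 : 0 <= (1 : R) by [].
rewrite (sum_sing_sqr g).
have hg : \sum_j rip (g j) (g j) <= dim * (4 * energy p A).
  apply: le_trans (smoothed_grad_le A l01) _; rewrite ler_pM2l //.
  have := energy_bound p1 p2 ltr01 pA.
  by rewrite powR1 mulr1 mul1r.
have hs : \sum_k sing g k <= dim * energy 1 A.
  apply: le_trans (sum_sing_smoothed A l01) _.
  rewrite energyE ?oner_neq0 // mulrA mulfV ?gt_eqF // mul1r.
  by apply: ler_sum => k _; rewrite powRr1 ?sing_ge0.
have hs0 : 0 <= \sum_k sing g k by apply: sumr_ge0 => k _; exact: sing_ge0.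
have hs2 : (\sum_k sing g k) ^+ 2 <= (dim * energy 1 A) ^+ 2.
  by rewrite ler_sqr ?nnegrE // (le_trans hs0 hs).
have hg0 : 0 <= \sum_j rip (g j) (g j) by apply: sumr_ge0 => k _; exact: rip_ge0.
move=> h; have {}h := le_trans h (ler_pM (sqr_ge0 _) hg0 hs2 hg).
have d3 : 0 < dim ^+ 3 by rewrite exprn_gt0.
rewrite -(ler_pM2l d3); move: h.
move: dim (energy 1 A) (energy p A) (noisy A) => d e1 e x h.
have -> : d ^+ 3 * x ^+ 2 = d * (d * x) ^+ 2 by ring.
by have -> : d ^+ 3 * (4 * e1 ^+ 2 * e) = (d * e1) ^+ 2 * (d * (4 * e)) by ring.
Qed.

End GradientContraction.

(** * High and low frequencies *)

Section FourierTail.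
Variables (R : realType) (n : nat).
Local Notation T := (qbasis n).
Implicit Types (S : (T * T)%type) (A : qmx R n).

Lemma wt_le S : (wt S <= n)%N.
Proof.
rewrite -[leqRHS](card_ord n) -sum1_card; apply: leq_sum => j _.
exact: leq_b1.
Qed.

Lemma sum_half_pow N : \sum_(k < N) (2^-1 : R) ^+ k <= 2.
Proof.
suff -> : \sum_(k < N) (2^-1 : R) ^+ k = 2 - 2 * 2^-1 ^+ N.
  by rewrite gerBl mulr_ge0 // exprn_ge0 // invr_ge0.
elim: N => [|N IH]; first by rewrite big_ord0 expr0 mulr1 subrr.
by rewrite big_ord_recr /= IH exprS; field.
Qed.

Lemma tail_scale (p : R) k m : 1 <= p -> (0 < m)%N ->
  ((4 ^+ k * m%:R)^-1 : R) `^ (p / 2) <= m%:R^-1 `^ (p / 2) * 2^-1 ^+ k.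
Proof.
move=> p1 m0; rewrite invfM mulrC powRM ?invr_ge0 ?exprn_ge0 //.
apply: ler_wpM2l; first exact: powR_ge0.
have -> : (2^-1 : R) ^+ k = (4 ^+ k)^-1 `^ 2^-1.
  rewrite powR12_sqrt ?invr_ge0 ?exprn_ge0 //.
  rewrite (_ : (4 ^+ k)^-1 = (2^-1 ^+ k) ^+ 2); last first.
    by rewrite -exprM mulnC exprM expr2 -invfM -natrM exprVn.
  by rewrite sqrtr_sqr ger0_norm // exprn_ge0 // invr_ge0.
apply: ger_powR; last by lra.
by rewrite invr_gt0 exprn_gt0 //= invf_le1 ?exprn_gt0 // exprn_ege1 // ler1n.
Qed.

(** The weight of frequency size at least [m] is captured by the scales
    [s = 4^-k / m]: some [s * wt S] lies in [1, 4), where [x / (1 + x)^2] is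
    bounded below, and the energy bounds at these scales sum geometrically. *)
Lemma fourier_tail (p : R) A m : 1 <= p -> p <= 2 -> (0 < m)%N ->
  psd (1%:M - A^t* *m A) ->
  \sum_(S : T * T | (m <= wt S)%N) fourier_weight A S <=
  50 * m%:R^-1 `^ (p / 2) * energy p A.
Proof.
move=> p1 p2 m0 pA; have m0' : 0 < m%:R :> R by rewrite ltr0n.
pose s (k : nat) : R := (4 ^+ k * m%:R)^-1.
have s0 k : 0 < s k by rewrite invr_gt0 mulr_gt0 // exprn_gt0.
have E0 : 0 <= energy p A by exact: powR_ge0.
have h1 : \sum_(S : T * T | (m <= wt S)%N) fourier_weight A S <=
    \sum_(k < n.+1) 25 / 4 * (s k * smoothed (s k) A).
  rewrite /smoothed; under [leRHS]eq_bigr do rewrite mulrA mulr_sumr.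
  rewrite exchange_big big_mkcond; apply: ler_sum => S _.
  have F0 (k : 'I_n.+1) : 0 <= 25 / 4 * s k * ((wt S)%:R * res_symb (s k) S ^+ 2 * fourier_weight A S).
    apply: mulr_ge0; first by apply: mulr_ge0; [lra | exact: ltW].
    exact: mulr_ge0 (mulr_ge0 (ler0n _ _) (sqr_ge0 _)) (fourier_weight_ge0 _ _).
  case: leqP => mS; last by apply: sumr_ge0.
  (* the scale at which [s k * wt S] lies in [1, 4) *)
  pose k := trunc_log 4 (wt S %/ m).
  have d0 : (0 < wt S %/ m)%N by rewrite divn_gt0.
  have /andP[kl ku] := trunc_log_bounds (isT : (1 < 4)%N) d0.
  have lo : (4 ^ k * m <= wt S)%N.
    by apply: leq_trans (leq_trunc_div (wt S) m); rewrite leq_mul2r kl orbT.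
  have hi : (wt S < 4 * (4 ^ k * m))%N by rewrite mulnA -expnS -ltn_divLR.
  have kn : (k < n.+1)%N.
    rewrite ltnS; apply: leq_trans (wt_le S); apply: leq_trans lo.
    by apply: leq_trans (leq_pmulr _ m0); rewrite ltnW // ltn_expl.
  rewrite (bigD1 (Ordinal kn)) //= -[leLHS]addr0; apply: lerD; last exact: sumr_ge0.
  have xE : 25 / 4 * s k * ((wt S)%:R * res_symb (s k) S ^+ 2 * fourier_weight A S) =
      25 / 4 * (s k * (wt S)%:R * (1 + s k * (wt S)%:R) ^- 2) * fourier_weight A S.
    by rewrite /res_symb exprVn; ring.
  rewrite xE -[leLHS]mul1r; apply: ler_wpM2r; first exact: fourier_weight_ge0.
  have x1 : 1 <= s k * (wt S)%:R.
    by rewrite /s ler_pdivlMl ?mulr_gt0 ?exprn_gt0 // mulr1 -natrX -natrM ler_nat.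
  have x4 : s k * (wt S)%:R <= 4.
    rewrite /s ler_pdivrMl ?mulr_gt0 ?exprn_gt0 // -natrX -natrM -natrM ler_nat mulnC.
    exact: ltnW.
  move: (s k * _) x1 x4 => x x1 x4.
  rewrite mulrA ler_pdivlMr ?mul1r; last by rewrite exprn_gt0 //; lra.
  nra.
apply: le_trans h1 _.
have h2 : \sum_(k < n.+1) 25 / 4 * (s k * smoothed (s k) A) <=
    \sum_(k < n.+1) 25 * m%:R^-1 `^ (p / 2) * energy p A * 2^-1 ^+ k.
  apply: ler_sum => k _; have h := energy_bound p1 p2 (s0 k) pA.
  have := ler_wpM2r E0 (tail_scale k p1 m0); rewrite -/(s k); move: h.
  by move: (s k * _) (_ `^ _) (_ `^ _) (2^-1 ^+ k) (energy p A) => *; lra.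
apply: le_trans h2 _; rewrite -mulr_sumr.
have := ler_wpM2l (_ : 0 <= 25 * m%:R^-1 `^ (p / 2) * energy p A) (sum_half_pow n.+1).
move=> /(_ _) h; apply: le_trans (h _) _; last by lra.
by rewrite !mulr_ge0 // powR_ge0.
Qed.

(** For [0 < wt S < m] the multiplier in [noisy] is at least
    [(4 ^- m * 2 ^- (2 m)) ^+ 2]. *)
Lemma fourier_low A m :
  \sum_(S : T * T | (S != 0) && (wt S < m)%N) fourier_weight A S <= 256 ^+ m * noisy A.
Proof.
rewrite /noisy mulr_sumr big_mkcond; apply: ler_sum => S _.
have nz0 : 0 <= noise_symb R S by case: (contractive_noise R n).
have r0 := res_symb_gt0 S (ler01 : 0 <= 1 :> R).
case: ifP => [/andP[Sn0 Sm]|_]; last first.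
  apply: mulr_ge0; first exact: exprn_ge0.
  exact: mulr_ge0 (mulr_ge0 (ler0n _ _) (sqr_ge0 _)) (fourier_weight_ge0 _ _).
rewrite mulrA -[leLHS]mul1r; apply: ler_wpM2r; first exact: fourier_weight_ge0.
have w1 : (1 : R) <= (wt S)%:R by rewrite ler1n lt0n wt_eq0.
have h1 : (4 ^+ m)^-1 <= noise_symb R S.
  apply: le_trans (noise_symb_ge R S); rewrite exprVn.
  by rewrite lef_pV2 ?posrE ?exprn_gt0 // ler_eXn2l ?ltr1n // ltnW.
have h2 : ((2 ^+ m)^-1 : R) <= res_symb 1 S.
  rewrite /res_symb mul1r lef_pV2 ?posrE ?exprn_gt0 //; last by rewrite ltr_pwDl.
  rewrite -natrX addrC natr1 ler_nat.
  by apply: leq_trans Sm _; rewrite ltnW // ltn_expl.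
have h3 : (4 ^+ m)^-1 * (2 ^+ m)^-1 ^+ 2 <= noise_symb R S * res_symb 1 S ^+ 2.
  apply: ler_pM => //; first by rewrite invr_ge0 exprn_ge0.
    exact: sqr_ge0.
  have i0 : 0 <= (2 ^+ m)^-1 :> R by rewrite invr_ge0 exprn_ge0.
  rewrite (expr2 (_ ^-1)) (expr2 (res_symb _ _)); exact: ler_pM.
have e : (4 ^+ m)^-1 * (2 ^+ m)^-1 ^+ 2 = (16 ^+ m)^-1 :> R.
  by rewrite -!exprVn -exprM mulnC exprM -exprMn; congr (_ ^+ m); field.
rewrite e in h3.
have h4 : (256 ^+ m)^-1 <= (noise_symb R S * res_symb 1 S ^+ 2) ^+ 2.
  have -> : (256 ^+ m)^-1 = ((16 ^+ m)^-1) ^+ 2 :> R.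
    by rewrite -!exprVn -exprM mulnC exprM; congr (_ ^+ m); field.
  by rewrite ler_sqr ?nnegrE ?invr_ge0 ?exprn_ge0 // mulr_ge0 ?sqr_ge0.
have p256 : 0 < 256 ^+ m :> R by rewrite exprn_gt0.
rewrite -ler_pdivrMl // mulr1; apply: le_trans h4 _.
by rewrite ler_peMl ?sqr_ge0.
Qed.

End FourierTail.

(** * Comparison of the energies *)

Section EnergyRatio.
Variables (R : realType) (n : nat).
Implicit Types (A : qmx R n) (p q : R).

Lemma energy_ge0 p A : 0 <= energy p A.
Proof. exact: powR_ge0. Qed.

Lemma sqr_le_powR (a b q : R) : 0 <= a -> 0 < q -> a `^ q <= b ->
  a ^+ 2 <= b `^ (2 / q).
Proof.
move=> a0 q0 ab; have -> : a ^+ 2 = (a `^ q) `^ (2 / q).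
  by rewrite -powRrM mulrC divfK ?lt0r_neq0 // (powR_mulrn 2).
have aq0 := powR_ge0 a q.
by apply: ge0_ler_powR; rewrite ?nnegrE ?divr_ge0 ?(ltW q0) // (le_trans aq0 ab).
Qed.

(** Young's inequality against the constant 1. *)
Lemma bernoulli_powR (x q : R) : 0 <= x -> 1 <= q -> x <= x `^ q / q + (1 - q^-1).
Proof.
move=> x0 q1; have [->|qn1] := eqVneq q 1.
  by rewrite powRr1 // divr1 invr1 subrr addr0.
have q_gt1 : 1 < q by rewrite lt_def qn1.
have q0 : 0 < q by lra.
have r0 : 0 < 1 - q^-1 by rewrite subr_gt0 invf_lt1.
have := @conjugate_powR R x 1 q (1 - q^-1)^-1 x0 ler01 q0.
rewrite invr_gt0 invrK => /(_ r0); rewrite addrC subrK => /(_ erefl).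
by rewrite mulr1 powR1 mul1r.
Qed.

(** Convexity in tangent form at the mean [t]: sum [bernoulli_powR] over [a k / t]. *)
Lemma power_mean (I : finType) (a : I -> R) (q d : R) :
  1 <= q -> (forall k, 0 <= a k) -> d = #|I|%:R -> 0 < d ->
  (d^-1 * \sum_k a k) `^ q <= d^-1 * \sum_k a k `^ q.
Proof.
move=> q1 a0 dE d0; set t := d^-1 * _.
have t0 : 0 <= t by rewrite mulr_ge0 ?invr_ge0 ?(ltW d0) // sumr_ge0.
have q0 : 0 < q by lra.
have [t_0|tn0] := eqVneq t 0.
  rewrite t_0 powR0 ?gt_eqF // mulr_ge0 ?invr_ge0 ?(ltW d0) // sumr_ge0 // => k _.
  exact: powR_ge0.
have tp : 0 < t by rewrite lt_def tn0.
have h : \sum_k a k / t <= \sum_k ((a k / t) `^ q / q + (1 - q^-1)).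
  by apply: ler_sum => k _; apply: bernoulli_powR => //; rewrite divr_ge0.
have e1 : \sum_k a k / t = d.
  by rewrite -mulr_suml /t invfM invrK mulrA mulrAC mulfV ?mul1r //;
    apply: contraNneq tn0 => s0; rewrite /t s0 mulr0.
have e2 : \sum_k ((a k / t) `^ q / q + (1 - q^-1)) =
    (\sum_k a k `^ q) / t `^ q / q + d * (1 - q^-1).
  rewrite big_split /= sumr_const -mulr_suml -[X in _ + X]mulr_natl -dE.
  congr (_ / q + _); rewrite mulr_suml; apply: eq_bigr => k _.
  by rewrite powRM ?invr_ge0 // -powR_inv1 // powRAC powR_inv1 // powR_ge0.
rewrite e1 e2 in h.
have tq : 0 < t `^ q by exact: powR_gt0.
rewrite -(ler_pM2l d0) mulrA mulfV ?gt_eqF // mul1r.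
move: h; move: (\sum_k _) (t `^ q) tq => S u u0 h.
have {}h : d / q <= S / u / q by lra.
by move: h; rewrite ler_pM2r ?invr_gt0 // ler_pdivlMr // mulrC.
Qed.

Lemma energy_power_mean q A : 1 <= q -> energy 1 A `^ q <= energy q A.
Proof.
move=> q1; have qn0 : q != 0 by rewrite gt_eqF //; lra.
rewrite !energyE ?oner_neq0 // (eq_bigr (sing (fun j => dj j A))) => [|k _].
  apply: power_mean => //; first exact: sing_ge0; last exact: dim_gt0.
  by rewrite card_ord card_qbasis natrX.
by rewrite powRr1 // sing_ge0.
Qed.

Lemma energy_eq0 q A : 1 <= q -> energy 1 A = 0 -> energy q A = 0.
Proof.
move=> q1; have qn0 : q != 0 by rewrite gt_eqF //; lra.
have dn0 : (2 ^+ n)^-1 != 0 :> R by rewrite invr_neq0 // gt_eqF // dim_gt0.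
rewrite !energyE ?oner_neq0 // => /eqP; rewrite mulf_eq0 (negPf dn0) /=.
rewrite psumr_eq0 => [/allP h|k _]; last exact: powR_ge0.
rewrite big1 ?mulr0 // => k _; have := h k; rewrite mem_index_enum => /(_ isT) /=.
by rewrite powRr1 ?sing_ge0 // => /eqP ->; rewrite powR0.
Qed.

Lemma lnplus_ge0 (x : R) : 0 <= lnplus x.
Proof. by rewrite /lnplus le_max lexx orbT. Qed.

(** The last hypothesis deals with a division by zero on the right-hand side,
    where the quotient takes the value 0. *)
Lemma lnplus_div_le (e a b : R) : 0 <= e -> 0 <= a -> a <= b ->
  (a = 0 -> b = 0) -> lnplus (e / b) <= lnplus (e / a).
Proof.
move=> e0 a0 ab ab0; rewrite {1}/lnplus ge_max lnplus_ge0 andbT.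
have [x1|x1] := leP (e / b) 1; first exact: le_trans (ln_le0 x1) (lnplus_ge0 _).
have bn0 : b != 0 by apply: contraTneq x1 => ->; rewrite invr0 mulr0 -leNgt.
have ap : 0 < a.
  by rewrite lt_def a0 andbT; apply: contraNneq bn0 => /ab0 ->.
have xy : e / b <= e / a.
  by rewrite ler_wpM2l // lef_pV2 ?posrE // (lt_le_trans ap ab).
have x0 : 0 < e / b by lra.
by rewrite /lnplus le_max ler_ln ?posrE ?xy //; lra.
Qed.

(** By the power mean inequality [q = 1] is the hardest case, so the
    logarithm may be taken at [q = 1] throughout. *)
Lemma lnplus_ratio p q A : 1 <= q ->
  lnplus (energy p A / energy q A `^ (2 / q)) <=
  lnplus (energy p A / energy 1 A ^+ 2).
Proof.
move=> q1; have q0 : 0 < q by lra.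
apply: lnplus_div_le; [exact: energy_ge0 | exact: sqr_ge0 | | ].
  exact: sqr_le_powR (energy_ge0 1 A) q0 (energy_power_mean A q1).
move/eqP; rewrite sqrf_eq0 => /eqP /(energy_eq0 q1) ->; rewrite powR0 //.
by rewrite lt0r_neq0 // divr_gt0.
Qed.

End EnergyRatio.

(** * Choice of the threshold and conclusion *)

Section TalagrandIsoperimetry.
Variable R : realType.

Lemma le_512_expR9 : (512 : R) <= expR 9.
Proof.
have h : (2 : R) <= expR 1 by have := expR_ge1Dx (1 : R); lra.
have -> : (9 : R) = 9%:R * 1 by rewrite mulr1.
rewrite expRM_natl; apply: (@le_trans _ _ (2 ^+ 9)); first by lra.
by rewrite lerXn2r ?nnegrE ?expR_ge0.
Qed.

(** The threshold [m] is of the order of the logarithm: it is chosen so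
    that the exponential loss [256 ^+ m] is paid by the ratio [E / F ^+ 2]. *)
Lemma balance_threshold (p V E F N : R) : 1 <= p -> p <= 2 -> 0 <= E -> 0 <= F ->
  N ^+ 2 <= 4 * F ^+ 2 * E ->
  (forall m, (0 < m)%N ->
     V <= (if (1 < m)%N then 256 ^+ m * N else 0) + 50 * m%:R^-1 `^ (p / 2) * E) ->
  V * (1 + lnplus (E / F ^+ 2)) `^ (p / 2) <= 20406 * E.
Proof.
move=> p1 p2 E0 F0 NFE; set x := E / F ^+ 2 => split.
have L0 := lnplus_ge0 x; have lnx : 0 < lnplus x -> lnplus x = ln x.
  by rewrite /lnplus lt_max ltxx orbF => /ltW/max_idPl.
move: (lnplus x) L0 lnx => L L0 lnx.
have L180 : 0 <= L / 18 by lra.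
have /andP[] := truncn_itv L180; move: (Num.truncn _) => k k_lo k_hi.
have := split k.+1 isT; set M := _ `^ (p / 2).
have mR : 0 < k.+1%:R :> R by rewrite ltr0n.
have M0 : 0 <= M by exact: powR_ge0.
have low : (if (1 < k.+1)%N then 256 ^+ k.+1 * N else 0) <= 1024 * M * E.
  case: ifP => [k1|_]; last by rewrite !mulr_ge0.
  have Lp : 0 < L.
    have : (1 : R) <= k%:R by rewrite ler1n.
    lra.
  have lx := lnx Lp.
  have x1 : 1 < x by rewrite ltNge; apply/negP => /ln_le0; rewrite -lx leNgt Lp.
  have Fp : 0 < F.
    rewrite lt_def F0 andbT; apply: contraTneq x1 => e.
    by rewrite /x e expr0n invr0 mulr0 -leNgt.
  have Ep : 0 < E.
    rewrite lt_def E0 andbT; apply: contraTneq x1 => e.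
    by rewrite /x e mul0r -leNgt.
  set e := Num.sqrt E.
  have e0 : 0 < e by rewrite sqrtr_gt0.
  have e2 : e ^+ 2 = E by rewrite sqr_sqrtr.
  have expL : expR (L / 2) = e / F.
    apply/eqP; rewrite -(eqrXn2 (isT : (0 < 2)%N)) ?expR_ge0 ?divr_ge0 ?(ltW e0) //.
    rewrite expr_div_n e2 -expRM_natl (_ : 2%:R * (L / 2) = L); last by field.
    by rewrite lx lnK // posrE; lra.
  have p512 : 512 ^+ k.+1 * F <= 512 * e.
    have : 512 ^+ k <= expR (L / 2).
      apply: (@le_trans _ _ (expR 9 ^+ k)).
        by rewrite lerXn2r ?nnegrE ?expR_ge0 // le_512_expR9.
      by rewrite -expRM_natl ler_expR; lra.
    rewrite expL ler_pdivlMr // => h.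
    by rewrite exprS -mulrA ler_pM2l //; lra.
  have NF : N <= 2 * F * e.
    apply: le_sqr_nneg; first by rewrite !mulr_ge0 // ltW.
    have -> : (2 * F * e) ^+ 2 = 4 * F ^+ 2 * e ^+ 2 by ring.
    by rewrite e2.
  have Mge : (2 ^+ k.+1)^-1 <= M.
    apply: (@le_trans _ _ (k.+1%:R^-1)).
      by rewrite lef_pV2 ?posrE ?exprn_gt0 // -natrX ler_nat ltnW // ltn_expl.
    rewrite -{1}[k.+1%:R^-1]powRr1 ?invr_ge0 ?(ltW mR) //; apply: ger_powR; last by lra.
    by rewrite invr_gt0 mR invf_le1 // ler1n.
  have p0 : 0 <= 256 ^+ k.+1 :> R by rewrite exprn_ge0.
  apply: le_trans (ler_wpM2l p0 NF) _.
  (* [512 = 256 * 2]: the factor [2 ^+ m] pays for [m `^ (p / 2)] *)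
  have e512 : 512 ^+ k.+1 = 256 ^+ k.+1 * 2 ^+ k.+1 :> R.
    by rewrite -exprMn; congr (_ ^+ k.+1); lra.
  have two0 : 0 < 2 ^+ k.+1 :> R by rewrite exprn_gt0.
  have : 256 ^+ k.+1 * F <= 512 * e * M.
    apply: (@le_trans _ _ (512 * e * (2 ^+ k.+1)^-1)); last first.
      by rewrite ler_wpM2l // mulr_ge0 // ltW.
    by rewrite ler_pdivlMr // mulrAC -e512.
  rewrite -e2 => h; have := ler_wpM2r (ltW e0) h.
  have -> : 256 ^+ k.+1 * (2 * F * e) = 2 * (256 ^+ k.+1 * F * e) by ring.
  have -> : 1024 * M * e ^+ 2 = 2 * (512 * e * M * e) by ring.
  by rewrite ler_pM2l.
(* [m > L / 18] gives [1 + L <= 19 m] *)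
have ML : M * (1 + L) `^ (p / 2) <= 19.
  rewrite /M -powRM ?invr_ge0 ?(ltW mR) //; last by lra.
  apply: (@le_trans _ _ (19 `^ (p / 2))).
    have le19 : k.+1%:R^-1 * (1 + L) <= 19.
      rewrite ler_pdivrMl //; have : (1 : R) <= k.+1%:R by rewrite ler1n.
      lra.
    apply: ge0_ler_powR; rewrite ?nnegrE //; try lra.
    by rewrite mulr_ge0 ?invr_ge0 ?(ltW mR) //; lra.
  rewrite -[leRHS]powRr1 //; apply: ler_powR; lra.
have l0 : 0 <= (1 + L) `^ (p / 2) by exact: powR_ge0.
move=> VM; have V' : V <= 1074 * M * E by lra.
apply: le_trans (ler_wpM2r l0 V') _.
have -> : 1074 * M * E * (1 + L) `^ (p / 2) = 1074 * (M * (1 + L) `^ (p / 2) * E) by ring.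
by have := ler_wpM2r E0 ML; move: (M * _ * E) => z; lra.
Qed.

(** The inequality at [q = 1], where all the analysis takes place. *)
Lemma variance_energy1 n (A : qmx R n) (p : R) : 1 <= p -> p <= 2 -> opnorm A <= 1 ->
  variance A * (1 + lnplus (energy p A / energy 1 A ^+ 2)) `^ (p / 2) <=
  20406 * energy p A.
Proof.
move=> p1 p2 /opnorm_le1_psd pA.
apply: (balance_threshold p1 p2 (energy_ge0 p A) (energy_ge0 1 A) (noisy_bound p1 p2 pA)).
move=> m m0; have -> : variance A =
    \sum_(S : qbasis n * qbasis n | (S != 0) && (wt S < m)%N) fourier_weight A S +
    \sum_(S : qbasis n * qbasis n | (m <= wt S)%N) fourier_weight A S.
  rewrite variance_fourier (bigID (fun S => (wt S < m)%N)) /=; congr (_ + _).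
  apply: eq_bigl => S; rewrite -leqNgt -wt_eq0 -lt0n.
  by case: (leqP m (wt S)) => h; rewrite ?andbF ?andbT // (leq_trans m0 h).
apply: lerD (fourier_tail p1 p2 m0 pA); case: ifP => m1; first exact: fourier_low.
rewrite big_pred0 // => S; rewrite -wt_eq0; apply/negbTE; rewrite negb_and negbK.
by case: (wt S) => // k; rewrite -leqNgt (leq_trans _ (ltn0Sn k)) // leqNgt m1.
Qed.

(** The factor [q / (2 (2 - q))] in front of the logarithm is at most
    [1 / (2 - q)], and raising to the power [p / 2 <= 1] keeps the loss
    below one factor [(2 - q)^-1]. *)
Lemma log_loss (K p q V E Lq L1 : R) : 0 < K -> 1 <= p -> p <= 2 -> 1 <= q -> q < 2 ->
  0 <= V -> 0 <= Lq -> Lq <= L1 -> V * (1 + L1) `^ (p / 2) <= K * E ->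
  K^-1 * (2 - q) * V <= E / (1 + q / (2 * (2 - q)) * Lq) `^ (p / 2).
Proof.
move=> K0 p1 p2 q1 q2 V0 Lq0 LL main.
have : 0 < 2 - q by rewrite subr_gt0.
have : 2 - q <= 1 by lra.
move: (2 - q) => r r1 r0.
have ri : 1 <= r^-1 by rewrite -invr1 lef_pV2 ?posrE.
have ri0 : 0 <= r^-1 by lra.
have qr : q / (2 * r) = q / 2 * r^-1 by field; rewrite gt_eqF.
rewrite qr; have base0 : 0 <= q / 2 * r^-1 * Lq by rewrite mulr_ge0 // mulr_ge0 //; lra.
have : q / 2 * r^-1 * Lq <= r^-1 * L1.
  by rewrite mulrAC mulrC; apply: ler_wpM2l => //; nra.
move: (_ * Lq) base0 => y y0 yL; set D := (1 + y) `^ (p / 2).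
have l1 : 0 <= 1 + L1 by lra.
have base : 1 + y <= r^-1 * (1 + L1) by rewrite mulrDr mulr1 lerD.
have ph0 : 0 <= p / 2 by lra.
have D0 : 0 < D by apply: powR_gt0; rewrite ltr_pwDl.
have DL : D * r <= (1 + L1) `^ (p / 2).
  have h : D <= (r^-1 * (1 + L1)) `^ (p / 2).
    by apply: ge0_ler_powR => //; rewrite nnegrE ?mulr_ge0 // addr_ge0.
  rewrite powRM // in h.
  have h2 : r^-1 `^ (p / 2) <= r^-1.
    rewrite -[leRHS]powRr1 //; apply: ler_powR => //.
    by rewrite ler_pdivrMr // mul1r.
  have := le_trans h (ler_wpM2r (powR_ge0 _ _) h2).
  by rewrite mulrC -ler_pdivlMr ?invr_gt0 // invrK.
have VD := le_trans (ler_wpM2l V0 DL) main.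
rewrite ler_pdivlMr // (_ : _ * D = K^-1 * (V * (D * r))); last by ring.
by rewrite ler_pdivrMl.
Qed.

End TalagrandIsoperimetry.

Theorem corollary4p4 (R : realType) :
  exists c : R, 0 < c /\
  exists C : R -> R -> R,
    (forall p q : R, 1 <= q -> q <= p -> p <= 2 -> q < 2 ->
       0 < C p q /\ c * (2 - q) <= C p q) /\
    (forall (n : nat) (A : qmx R n) (p q : R),
       (1 <= n)%N -> opnorm A <= 1 ->
       1 <= q -> q <= p -> p <= 2 -> q < 2 ->
       C p q * variance A <=
         if variance A == 0 then 0
         else energy p A /
           (1 + q / (2 * (2 - q)) * lnplus (energy p A / energy q A `^ (2 / q)))
             `^ (p / 2)).
Proof.
have K0 : 0 < 20406 :> R by [].
exists 20406^-1; split; first by rewrite invr_gt0.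
exists (fun _ q => 20406^-1 * (2 - q)); split=> [p q q1 qp p2 q2|n A p q _ hA q1 qp p2 q2].
  by rewrite lexx mulr_gt0 ?invr_gt0 ?subr_gt0.
case: eqP => [->|_]; first by rewrite mulr0.
have p1 : 1 <= p by exact: le_trans q1 qp.
have V0 : 0 <= variance A by exact: sqr_ge0.
exact: (log_loss K0 p1 p2 q1 q2 V0 (lnplus_ge0 _) (lnplus_ratio p A q1)
  (variance_energy1 p1 p2 hA)).
Qed.
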